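(* Let $G,H$ be finitely generated groups with homeomorphic Morse boundaries. Then for every homeomorphism $p:\partial_*G\to\partial_*H$ there exists a bijection $\hat p:G\to H$ which induces $p$.
   Context: A $(\lambda,\epsilon)$-quasi-geodesic is a (not necessarily continuous) map $\eta$ from an interval with $\frac1\lambda|s-t|-\epsilon\le d(\eta(s),\eta(t))\le\lambda|s-t|+\epsilon$. A Morse gauge is a map $M:\mathbb{R}_{\ge1}\times\mathbb{R}_{\ge0}\to\mathbb{R}_{\ge0}$. A geodesic $\gamma$ in a geodesic metric space is $M$-Morse if every $(\lambda,\epsilon)$-quasi-geodesic with endpoints on $\gamma$ lies in the closed $M(\lambda,\epsilon)$-neighbourhood of $\gamma$; it is Morse if it is $M$-Morse for some $M$. Put $\delta_M=\max\{4M(1,2M(5,0))+2M(5,0),\,8M(3,0)\}$. Let $(X,e)$ be a pointed proper geodesic metric space. As a set, the Morse boundary $\partial_*X$ is the set of classes $[\xi]$ of Morse geodesic rays, two rays being equivalent if they have finite Hausdorff distance; its elements are called Morse directions. $\partial_*^MX\subset\partial_*X$ is the set of classes containing an $M$-Morse geodesic ray starting at $e$; such a ray is called an $M$-Morse realization of the class. For $z\in\partial_*^MX$ and $n\in\mathbb{N}$, $U_n^M(z)$ is the set of classes $[\eta]$ of $M$-Morse geodesic rays $\eta$ starting at $e$ such that $d(\eta(t),\xi(t))<\delta_M$ for all $t\in[0,n]$ and all $M$-Morse realizations $\xi$ of $z$. $\partial_*^MX$ carries the topology with fundamental systems of neighbourhoods $\{U_n^M(z)\}_{n}$ (a set $V$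 is open iff for each $z\in V$ some $U_n^M(z)\subset V$). $\partial_*X$ carries the direct limit topology: a subset is open iff its intersection with every $\partial_*^MX$ is open in $\partial_*^MX$. A point $x\in X$ is $M$-Morse if some geodesic segment from $e$ to $x$ is $M$-Morse. For $z\in\partial_*^MX$, the filled neighbourhood $\tilde U_n^M(z)$ is the set consisting of the classes $[\eta]$ (for rays) and of the endpoints of $\eta$ (for finite segments) of all $M$-Morse geodesics $\eta$, infinite rays or finite segments of length at least $n$, starting at $e$, such that $d(\eta(t),\xi(t))<\delta_M$ for all $t\in[0,n]$ and all $M$-Morse realizations $\xi$ of $z$. For each finitely generated group $G$ a Cayley graph with respect to a finite generating set is fixed, with base point the identity, and $\partial_*G$ and the notions above refer to it. A sequence $(x_n)_n$ of $M$-Morse points of $G$ converges to $z\in\partial_*^MG$ if for every integer $k$ all but finitely many $x_n$ lie in $\tilde U_k^M(z)$; a sequence of points is said to converge to a Morse direction if this holds for some Morse gauge $M$. A bijection $\hat p:G\to H$ induces a homeomorphism $p:\partial_*G\to\partial_*H$ if for every Morse gauge $M$: for every sequence $(x_n)_n$ of $M$-Morse points of $G$ converging to some $z$, the sequence $(\hat p(x_n))_n$ converges to $p(z)$; and for every sequence $(x_n')_n$ of $M$-Morse points of $H$ converging to some $z'$, the sequence $(\hat p^{-1}(x_n'))_n$ converges to $p^{-1}(z')$.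
   Formalization: Added hypothesis: if G or H is finite, then G and H have the same cardinality. Without it the claim fails, e.g. for G trivial and H = Z^2, whose Morse boundaries are both empty although there is no bijection from G to H. *)

(* Defs.v *)
From HB Require Import structures.
From mathcomp Require Import all_boot all_order all_algebra.
From mathcomp Require Import all_classical all_reals.
From mathcomp Require Import topology normedtype.
From mathcomp Require Import ring.

Set Implicit Arguments.
Unset Strict Implicit.
Unset Printing Implicit Defensive.

Import Order.TTheory GRing.Theory Num.Theory.

Local Open Scope classical_set_scope.
Local Open Scope ring_scope.

Section MorseGeodesics.
Context {R : realType} {X : metricType R}.
Implicit Types (A B : set X) (I : interval R) (eta gamma xi : R -> X).

(* Maps from an interval I to X are total functions R -> X of which only the
   restriction to I matters. *)

Definition quasi_geodesic (lambda eps : R) I eta : Prop :=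
  forall s t : R, s \in I -> t \in I ->
    lambda^-1 * `|s - t| - eps <= mdist (eta s) (eta t)
                               <= lambda * `|s - t| + eps.

Definition geodesic I gamma : Prop :=
  forall s t : R, s \in I -> t \in I -> mdist (gamma s) (gamma t) = `|s - t|.

Definition closed_nbhd A (r : R) : set X :=
  [set x | (edist_inf A x <= r%:E)%E].

Definition finite_hausdorff_dist A B : Prop :=
  exists C : R, A `<=` closed_nbhd B C /\ B `<=` closed_nbhd A C.

(* Only the values at lambda >= 1 and eps >= 0 are meaningful. *)
Record morse_gauge := MorseGauge {
  gauge_fun :> R -> R -> R;
  gauge_ge0 : forall lambda eps : R,
    1 <= lambda -> 0 <= eps -> 0 <= gauge_fun lambda eps
}.

Implicit Type M : morse_gauge.

Definition morse_delta M : R :=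
  Num.max (4 * M 1 (2 * M 5 0) + 2 * M 5 0) (8 * M 3 0).

Definition morse_geodesic M I gamma : Prop :=
  geodesic I gamma /\
  forall (lambda eps a b : R) eta, 1 <= lambda -> 0 <= eps -> a <= b ->
    quasi_geodesic lambda eps `[a, b] eta ->
    (gamma @` [set` I]) (eta a) -> (gamma @` [set` I]) (eta b) ->
    forall t, t \in `[a, b] ->
      closed_nbhd (gamma @` [set` I]) (M lambda eps) (eta t).

Definition morse_ray gamma : Prop := exists M, morse_geodesic M `[0, +oo[ gamma.

Definition morse_class xi : set (R -> X) :=
  [set eta | morse_ray eta /\
     finite_hausdorff_dist (eta @` `[0, +oo[) (xi @` `[0, +oo[)].

End MorseGeodesics.

Arguments morse_gauge R : clear implicits.

(* The underlying set does not depend on the base point e, but the strata and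
   the topology do. *)
Record morse_boundary {R : realType} {X : metricType R} (e : X) :=
  MorseDirection {
    rays : set (R -> X);
    raysP : exists2 xi, morse_ray xi & rays = morse_class xi
  }.

HB.instance Definition _ (R : realType) (X : metricType R) (e : X) :=
  gen_eqMixin (morse_boundary e).
HB.instance Definition _ (R : realType) (X : metricType R) (e : X) :=
  gen_choiceMixin (morse_boundary e).

Section MorseBoundary.
Context {R : realType} {X : metricType R} {e : X}.
Implicit Types (M : morse_gauge R) (z y : morse_boundary e) (n : nat).

Definition morse_realization M z (xi : R -> X) : Prop :=
  [/\ rays z xi, morse_geodesic M `[0, +oo[ xi & xi 0 = e].

Definition morse_stratum M : set (morse_boundary e) :=
  [set z | exists xi, morse_realization M z xi].

Definition fellow_travels M z n (eta : R -> X) : Prop :=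
  forall xi, morse_realization M z xi ->
    forall t : R, t \in `[0, n%:R] -> mdist (eta t) (xi t) < morse_delta M.

(* The class of a Morse ray eta is the direction y such that rays y eta, so
   morse_realization M y eta says that y is the class of the M-Morse ray eta
   and that eta starts at e. *)
Definition morse_nbhd M z n : set (morse_boundary e) :=
  [set y | exists2 eta, morse_realization M y eta & fellow_travels M z n eta].

Definition stratum_open M (V : set (morse_boundary e)) : Prop :=
  V `<=` morse_stratum M /\
  forall z, V z -> exists n, morse_nbhd M z n `<=` V.

Definition morse_open (V : set (morse_boundary e)) : Prop :=
  forall M, stratum_open M (V `&` morse_stratum M).

Lemma morse_nbhd_stratum M z n : morse_nbhd M z n `<=` morse_stratum M.
Proof. by move=> y [eta yeta _]; exists eta. Qed.

Lemma morse_nbhd_le M z m n :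
  (m <= n)%N -> morse_nbhd M z n `<=` morse_nbhd M z m.
Proof.
move=> mn y [eta yeta H]; exists eta => // xi zxi t.
rewrite in_itv/= => /andP[t0 tm]; apply: H => //.
by rewrite in_itv/= t0 (le_trans tm)// ler_nat.
Qed.

Lemma morse_openT : morse_open setT.
Proof.
move=> M; split=> [y []//|z _]; exists 0%N => y /morse_nbhd_stratum.
by split.
Qed.

Lemma morse_openI : setI_closed morse_open.
Proof.
move=> U V Uo Vo M; split=> [y []//|z [[Uz Vz] Mz]].
have [_ /(_ z (conj Uz Mz))[m mU]] := Uo M.
have [_ /(_ z (conj Vz Mz))[n nV]] := Vo M.
exists (maxn m n) => y yB.
have [Uy My] := mU y (morse_nbhd_le (leq_maxl _ _) yB).
by have [Vy _] := nV y (morse_nbhd_le (leq_maxr _ _) yB).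
Qed.

Lemma morse_open_bigU (I : Type) (f : I -> set (morse_boundary e)) :
  (forall i, morse_open (f i)) -> morse_open (\bigcup_i f i).
Proof.
move=> fo M; split=> [y []//|z [[i _ fiz] Mz]].
have [_ /(_ z (conj fiz Mz))[n nf]] := fo i M.
by exists n => y /nf[fiy My]; split=> //; exists i.
Qed.

HB.instance Definition _ := isOpenTopological.Build (morse_boundary e)
  morse_openT morse_openI morse_open_bigU.

(* The endpoint of a segment eta on [0, L] starting at e is eta L. *)
Definition filled_nbhd M z n : set (morse_boundary e + X) :=
  [set p | match p with
           | inl y => morse_nbhd M z n y
           | inr x => exists (L : R) (eta : R -> X),
               [/\ n%:R <= L, morse_geodesic M `[0, L] eta, eta 0 = e,
                   eta L = x & fellow_travels M z n eta]
           end].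

Definition morse_point M (x : X) : Prop :=
  exists (L : R) (eta : R -> X),
    [/\ 0 <= L, eta 0 = e, eta L = x & morse_geodesic M `[0, L] eta].

Definition morse_cvg_gauge M (x : nat -> X) z : Prop :=
  [/\ forall n, morse_point M (x n), morse_stratum M z &
      forall k, \forall n \near \oo, filled_nbhd M z k (inr (x n))].

Definition morse_cvg (x : nat -> X) z : Prop := exists M, morse_cvg_gauge M x z.

End MorseBoundary.

Definition generates (G : groupType) (S : seq G) : Prop :=
  forall g : G, exists2 w : seq G,
    all (fun s => (s \in S) || (s^-1%g \in S)) w & g = (\prod_(s <- w) s)%g.

Record fg_group := FgGroup {
  fg_sort :> groupType;
  fg_gens : seq fg_sort;
  fg_gensP : generates fg_gens
}.

Section CayleyGraph.
Context {R : realType} {G : fg_group}.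
Implicit Types (g h : G) (s t l : R).

Definition adjacent g h : bool :=
  (g != h) && (((g^-1 * h)%g \in fg_gens G) || ((h^-1 * g)%g \in fg_gens G)).

(* Points are given by barycentric coordinates: edge_point g h t lies at
   distance t from g on the edge from g to h; g itself is edge_point g g t. *)
Definition edge_point g h t : G -> R :=
  fun x => (1 - t) * (x == g)%:R + t * (x == h)%:R.

Definition on_cayley_graph (w : G -> R) : Prop :=
  exists g h t, [/\ (g == h) || adjacent g h, 0 <= t <= 1
                  & w = edge_point g h t].

(* edge_path v w l: v and w are joined by a concatenation, of total length l, of
   finitely many segments each contained in an edge. *)
Inductive edge_path : (G -> R) -> (G -> R) -> R -> Prop :=
| edge_path_nil w : edge_path w w 0
| edge_path_cons g h s t w l :
    adjacent g h -> 0 <= s <= 1 -> 0 <= t <= 1 ->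
    edge_path (edge_point g h t) w l ->
    edge_path (edge_point g h s) w (`|s - t| + l).

Lemma adjacent_sym g h : adjacent g h = adjacent h g.
Proof. by rewrite /adjacent eq_sym orbC. Qed.

Lemma edge_pointxx g t : edge_point g g t = edge_point g g 0.
Proof.
by apply/funext => x; rewrite /edge_point; ring.
Qed.

Lemma edge_point0 g h : edge_point g h 0 = edge_point g g 0.
Proof. by apply/funext => x; rewrite /edge_point; ring. Qed.

Lemma edge_point1 g h : edge_point g h 1 = edge_point h h 0.
Proof.
by apply/funext => x; rewrite /edge_point; ring.
Qed.

Lemma edge_path_cat u v w k l :
  edge_path u v k -> edge_path v w l -> edge_path u w (k + l).
Proof.
move=> uv; elim: uv => {u v k} [u|g h s t v k gh s01 t01 _ IH] vw.
  by rewrite add0r.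
by rewrite -addrA; apply: edge_path_cons => //; exact: IH.
Qed.

Lemma edge_path_sym v w l : edge_path v w l -> edge_path w v l.
Proof.
elim=> {v w l} [w|g h s t w l gh s01 t01 _ IH]; first exact: edge_path_nil.
rewrite addrC; apply: (edge_path_cat IH).
by rewrite distrC -[`|_|]addr0; apply: edge_path_cons => //; exact: edge_path_nil.
Qed.

Lemma edge_path_ge v w l : edge_path v w l -> forall x, `|v x - w x| <= l.
Proof.
elim=> {v w l} [w x|g h s t w l /andP[gh _] s01 t01 _ IH x].
  by rewrite subrr normr0.
apply: (le_trans (ler_distD (edge_point g h t x) _ _)).
apply: lerD (IH x); rewrite /edge_point.
have -> : (1 - s) * (x == g)%:R + s * (x == h)%:R -
    ((1 - t) * (x == g)%:R + t * (x == h)%:R) =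
    (s - t) * ((x == h)%:R - (x == g)%:R) by ring.
rewrite normrM ler_piMr//.
case: (x =P g) => [->|_]; first by rewrite (negbTE gh) sub0r normrN normr1.
by case: eqP; rewrite subr0 ?normr1 ?normr0.
Qed.

Lemma edge_path_vertex g (w : seq G) :
  all (fun a => (a \in fg_gens G) || (a^-1%g \in fg_gens G)) w ->
  exists l, edge_path (edge_point g g 0)
    (edge_point (g * \prod_(a <- w) a)%g (g * \prod_(a <- w) a)%g 0) l.
Proof.
elim: w g => [|a w IH] g /=.
  by move=> _; exists 0; rewrite big_nil mulg1; exact: edge_path_nil.
move=> /andP[aS /(IH (g * a)%g)[l gl]]; rewrite big_cons mulgA.
have [ga|gna] := eqVneq g (g * a)%g; first by exists l; rewrite -ga in gl *.
exists (`|0 - 1| + l); rewrite -(edge_point0 g (g * a)%g).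
apply: edge_path_cons; rewrite ?lexx ?ler01 ?edge_point1//.
by rewrite /adjacent gna mulKg invgM mulgVK.
Qed.

Lemma edge_path_to_vertex w : on_cayley_graph w ->
  exists g l, edge_path w (edge_point g g 0) l.
Proof.
move=> [g [h [t [/orP[/eqP <-|gh] t01 ->]]]]; exists g.
  by exists 0; rewrite edge_pointxx; exact: edge_path_nil.
exists (`|t - 0| + 0); apply: edge_path_cons => //; first by rewrite lexx ler01.
by rewrite edge_point0; exact: edge_path_nil.
Qed.

Lemma edge_path_connected v w : on_cayley_graph v -> on_cayley_graph w ->
  exists l, edge_path v w l.
Proof.
move=> /edge_path_to_vertex[g [k vg]] /edge_path_to_vertex[h [l wh]].
have [u uS ghu] := fg_gensP (g^-1 * h)%g.
have [m] := edge_path_vertex g uS; rewrite -ghu mulgA mulgV mul1g => gh.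
exists (k + (m + l)); apply: (edge_path_cat vg); apply: (edge_path_cat gh).
exact: edge_path_sym.
Qed.

End CayleyGraph.

Record cayley_graph (R : realType) (G : fg_group) := CayleyPoint {
  coords : G -> R;
  coordsP : on_cayley_graph coords
}.

HB.instance Definition _ (R : realType) (G : fg_group) :=
  gen_eqMixin (cayley_graph R G).
HB.instance Definition _ (R : realType) (G : fg_group) :=
  gen_choiceMixin (cayley_graph R G).

Section CayleyMetric.
Context {R : realType} {G : fg_group}.
Implicit Types x y z : cayley_graph R G.

Definition path_lengths x y : set R := [set l | edge_path (coords x) (coords y) l].

Definition cayley_dist x y : R := inf (path_lengths x y).

Lemma path_lengths_neq0 x y : path_lengths x y !=set0.
Proof. exact: edge_path_connected (coordsP x) (coordsP y). Qed.

Lemma path_lengths_ge0 x y : lbound (path_lengths x y) 0.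
Proof. by move=> l /edge_path_ge/(_ 1%g); exact: le_trans. Qed.

Lemma path_lengths_has_inf x y : has_inf (path_lengths x y).
Proof.
split; first exact: path_lengths_neq0.
by exists 0; exact: path_lengths_ge0.
Qed.

Lemma cayley_distxx x : cayley_dist x x = 0.
Proof.
apply/eqP; rewrite eq_le; apply/andP; split.
  by apply: ge_inf; [exact: (path_lengths_has_inf x x).2|exact: edge_path_nil].
by apply: lb_le_inf; [exact: path_lengths_neq0|exact: path_lengths_ge0].
Qed.

Lemma cayley_dist_eq0 x y : cayley_dist x y = 0 -> x = y.
Proof.
move=> xy0; have xy : coords x = coords y.
  apply/funext => g; apply/eqP; rewrite -subr_eq0 -normr_le0 -xy0.
  apply: lb_le_inf; first exact: path_lengths_neq0.
  by move=> l /edge_path_ge; exact.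
case: x y xy {xy0} => [x xP] [y yP] /= xy.
by move: xP; rewrite xy => xP; congr CayleyPoint; exact: Prop_irrelevance.
Qed.

Lemma cayley_dist_sym x y : cayley_dist x y = cayley_dist y x.
Proof. by congr inf; apply/seteqP; split=> l; exact: edge_path_sym. Qed.

Lemma cayley_dist_triangle y x z :
  cayley_dist x z <= cayley_dist x y + cayley_dist y z.
Proof.
apply/ler_addgt0Pl => eps eps0.
have e20 : 0 < eps / 2 by rewrite divr_gt0.
have [k xy /ltW ky] := inf_adherent e20 (path_lengths_has_inf x y).
have [l yz /ltW lz] := inf_adherent e20 (path_lengths_has_inf y z).
apply: (@le_trans _ _ (k + l)).
  by apply: ge_inf; [exact: (path_lengths_has_inf x z).2|exact: edge_path_cat xy yz].
by rewrite [eps]splitr [leRHS]addrC [leRHS]addrACA lerD.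
Qed.

HB.instance Definition _ := isMetric.Build R (cayley_graph R G)
  cayley_distxx cayley_dist_eq0 cayley_dist_sym cayley_dist_triangle.

Lemma vertexP (g : G) : on_cayley_graph (edge_point g g (0 : R)).
Proof. by exists g, g, 0; split=> //; rewrite ?eqxx ?lexx ?ler01. Qed.

End CayleyMetric.

Definition vertex (R : realType) (G : fg_group) (g : G) : cayley_graph R G :=
  CayleyPoint (vertexP g).

Definition group_morse_boundary (R : realType) (G : fg_group) :=
  morse_boundary (vertex R (1%g : G)).

(* q is the inverse of p. *)
Definition homeomorphism (T U : topologicalType) (p : T -> U) (q : U -> T) :=
  [/\ cancel p q, cancel q p, continuous p & continuous q].

Definition preserves_morse_cvg (R : realType) (G H : fg_group) (phat : G -> H)
    (p : group_morse_boundary R G -> group_morse_boundary R H) : Prop :=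
  forall (M : morse_gauge R) (x : nat -> G) (z : group_morse_boundary R G),
    morse_cvg_gauge M (fun n => vertex R (x n)) z ->
    morse_cvg (fun n => vertex R (phat (x n))) (p z).

(* qhat and q are the inverses of phat and p. *)
Definition induces (R : realType) (G H : fg_group)
    (phat : G -> H) (qhat : H -> G)
    (p : group_morse_boundary R G -> group_morse_boundary R H)
    (q : group_morse_boundary R H -> group_morse_boundary R G) : Prop :=
  preserves_morse_cvg phat p /\ preserves_morse_cvg qhat q.

(* Main.v *)
(* A direction is represented by a chosen ray from the base point. A sequence of
   directions converges iff these rays are uniformly Morse and fellow-travel the
   limit ray on longer and longer segments: uniformity holds because a set with
   finitely many points in each stratum is closed, and fellow-travelling by
   Arzela-Ascoli. If the boundary is nonempty there is a bi-infinite Morse line,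
   and translating it to g gives a direction sh g whose ray passes near g as soon
   as g or that ray is Morse; thus g_n -> z iff sh g_n -> z and g_n leaves finite
   sets. Conversely a point far enough along the ray of a direction y has almost
   the same Morse constants as y, so choosing such points for the directions
   p (sh g), and symmetrically for q (sh h), gives injections G -> H and H -> G
   compatible with convergence; the Cantor-Bernstein bijection agrees with one of
   them at every point. *)

Require Import Defs.
From mathcomp Require Import all_boot all_order all_algebra.
From mathcomp Require Import all_classical all_reals.
From mathcomp Require Import ereal topology normedtype.
From mathcomp Require Import ring lra.

Set Implicit Arguments.
Unset Strict Implicit.
Unset Printing Implicit Defensive.

Import Order.TTheory GRing.Theory Num.Theory.
Import numFieldNormedType.Exports.

Local Open Scope classical_set_scope.
Local Open Scope ring_scope.


(** Convergence of points asks for one gauge valid along the whole sequence and for a tolerance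
    depending on that gauge, while [p] is only a homeomorphism: nothing about it mentions gauges. So
    gauges are never compared across [p]. Only convergence of sequences of directions passes through
    [p], and a gauge is recovered from the topology on the other side. To return from a point to its
    direction, the Morse constants of an infinite ray must be read off a finite stretch. This works
    for each constant separately, beyond a threshold that depends on the constant. Hence the level
    [j] in [far_point]: the point attached to [g] controls the constants numbered up to the index of
    [g] in an enumeration of the group. A convergent sequence leaves finite sets, so each constant
    is controlled for all but finitely many terms, and the remaining terms are absorbed into a
    maximum. All estimates are coarse: nearest points are taken up to 1, and arbitrary points are
    joined by quasi-geodesics with constants 1 and 2. *)

Section CoarseIntermediateValue.
Context {R : realType}.
Implicit Types f : R -> R.

(** Take [x] with [f x <= w] within [1 / k] of the supremum of such points. A step of length at most
    [1 / k] reaches a point where [f] is at least [w], and [f] grows by at most [1 + c] on the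
    way. *)
Lemma coarse_ivt_le f (a b c k w : R) : 0 < k -> a <= b ->
  {in `[a, b] &, forall x y, `|f x - f y| <= k * `|x - y| + c} ->
  f a <= w <= f b -> exists2 x, x \in `[a, b] & `|f x - w| <= c + 1.
Proof.
move=> k0 ab flip /andP[faw wfb].
pose A := [set x | x \in `[a, b] /\ f x <= w].
have Aa : A a by split=> //; rewrite in_itv/= lexx.
have supA : has_sup A.
  by split; [exists a|exists b => x [xab _]; move: xab; rewrite in_itv/= => /andP[]].
have ki0 : 0 < k^-1 by rewrite invr_gt0.
have [x [xab fxw] xsup] := sup_adherent ki0 supA.
have [y yab [xy fyw]] : exists2 y, y \in `[a, b] & `|x - y| <= k^-1 /\ w <= f y.
  move: (xab); rewrite in_itv/= => /andP[ax xb].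
  have [bx|bx] := leP b (x + k^-1).
    exists b; first by rewrite in_itv/= lexx ab.
    by rewrite distrC ger0_norm ?subr_ge0//; split=> //; lra.
  have xk : x + k^-1 \in `[a, b] by rewrite in_itv/=; apply/andP; split; lra.
  exists (x + k^-1) => //; split.
    by rewrite opprD addrA subrr add0r normrN ger0_norm// ltW.
  rewrite leNgt; apply/negP => /ltW fw.
  have : x + k^-1 <= sup A by apply: ub_le_sup; [exact: supA.2|split].
  lra.
exists x => //; have fxy := flip _ _ xab yab.
have kxy : k * `|x - y| <= 1 by rewrite -ler_pdivlMl// mulr1.
rewrite distrC ger0_norm ?subr_ge0//.
by move: fxy; rewrite ler_norml => /andP[]; lra.
Qed.

Lemma coarse_ivt f (a b c k w : R) : 0 < k -> a <= b ->
  {in `[a, b] &, forall x y, `|f x - f y| <= k * `|x - y| + c} ->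
  f a <= w <= f b \/ f b <= w <= f a ->
  exists2 x, x \in `[a, b] & `|f x - w| <= c + 1.
Proof.
move=> k0 ab flip [|wf]; first exact: (@coarse_ivt_le f _ _ _ k).
have [||x xab] := @coarse_ivt_le (\- f) a b c k (- w) k0 ab.
- by move=> x y xab yab /=; rewrite -opprD normrN; exact: flip.
- by rewrite /= !lerN2 andbC.
- by move=> xw; exists x => //; rewrite -normrN opprD.
Qed.

(** If [f r] overshoots an end value, then [f] crosses that value between [r] and the opposite end.
    In the application [f] gives positions, along a geodesic, of points near a quasi-geodesic; the
    last two cases then say that the quasi-geodesic is near one of its endpoints twice, with [r] in
    between. *)
Lemma coarse_ivt_trichotomy f (a b c k r : R) : 0 < k -> r \in `[a, b] ->
  {in `[a, b] &, forall x y, `|f x - f y| <= k * `|x - y| + c} ->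
  [\/ Num.min (f a) (f b) <= f r <= Num.max (f a) (f b),
      exists2 x, x \in `[a, r] & `|f x - f b| <= c + 1 |
      exists2 x, x \in `[r, b] & `|f x - f a| <= c + 1].
Proof.
move=> k0; rewrite in_itv/= => /andP[ar rb] flip.
have sub1 : {in `[a, r] &, forall x y, `|f x - f y| <= k * `|x - y| + c}.
  move=> x y; rewrite !in_itv/= => /andP[ax xr] /andP[ay yr].
  by apply: flip; rewrite in_itv/=; apply/andP; split=> //; lra.
have sub2 : {in `[r, b] &, forall x y, `|f x - f y| <= k * `|x - y| + c}.
  move=> x y; rewrite !in_itv/= => /andP[ax xr] /andP[ay yr].
  by apply: flip; rewrite in_itv/=; apply/andP; split=> //; lra.
have [|] := boolP (Num.min (f a) (f b) <= f r <= Num.max (f a) (f b)).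
  by constructor 1.
rewrite ge_min le_max negb_and !negb_or -!ltNge => /orP[]/andP[rfa rfb].
- have [fab|/ltW fab] := leP (f a) (f b).
  + constructor 3; apply: (coarse_ivt k0 rb sub2); left.
    by rewrite fab (ltW rfa).
  + constructor 2; apply: (coarse_ivt k0 ar sub1); right.
    by rewrite fab (ltW rfb).
- have [fab|/ltW fab] := leP (f a) (f b).
  + constructor 2; apply: (coarse_ivt k0 ar sub1); left.
    by rewrite fab (ltW rfb).
  + constructor 3; apply: (coarse_ivt k0 rb sub2); right.
    by rewrite fab (ltW rfa).
Qed.

End CoarseIntermediateValue.

(** * Coarse geometry of Morse geodesics *)

Section CloseTo.
Context {R : realType} {X : metricType R}.
Implicit Types (I J : interval R) (g eta : R -> X) (M N : morse_gauge R).

(** The infimum in [closed_nbhd] is extended-real and need not be attained. Here a parameter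
    realizing the bound is named; passing from [closed_nbhd] to this form costs 1. *)
Definition close_to I g (C : R) (x : X) := exists2 u, u \in I & mdist x (g u) <= C.

Lemma close_to_le I g C D x : C <= D -> close_to I g C x -> close_to I g D x.
Proof. by move=> CD [u uI xu]; exists u => //; exact: le_trans CD. Qed.

Lemma close_toD I g C D x y :
  mdist x y <= D -> close_to I g C y -> close_to I g (D + C) x.
Proof.
move=> xy [u uI yu]; exists u => //.
by apply: (le_trans (metric_triangle _ y _)); exact: lerD.
Qed.

Lemma close_to_closed_nbhd I g C x :
  close_to I g C x -> closed_nbhd (g @` [set` I]) C x.
Proof.
move=> [u uI xu]; apply: (@le_trans _ _ (edist (x, g u))).
  by apply: ge_ereal_inf; exists (edist (x, g u)) => //; exists (g u) => //; exists u.
apply/lee_addgt0Pr => e e0; rewrite -EFinD; apply: edist_fin => /=.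
  by rewrite ltr_wpDl// (le_trans (mdist_ge0 _ _) xu).
by rewrite ballEmdist/= (le_lt_trans xu)// ltrDl.
Qed.

Lemma closed_nbhd_close_to I g C x :
  closed_nbhd (g @` [set` I]) C x -> close_to I g (C + 1) x.
Proof.
rewrite /closed_nbhd/= => Cx.
have : (edist_inf (g @` [set` I]) x < (C + 1)%:E)%E.
  by rewrite (le_lt_trans Cx)// lte_fin ltrDl.
move=> /ereal_inf_lt[_ [_ [u uI <-] <-]] /edist_lt_ball/=.
by rewrite ballEmdist => /ltW ?; exists u.
Qed.

Lemma finite_hausdorff_distP I J g eta :
  finite_hausdorff_dist (g @` [set` I]) (eta @` [set` J]) <->
  exists C, (forall t, t \in I -> close_to J eta C (g t)) /\
            (forall t, t \in J -> close_to I g C (eta t)).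
Proof.
split=> [[C [gC etaC]]|[C [gC etaC]]].
  by exists (C + 1); split=> t tI; apply: closed_nbhd_close_to;
    [apply: gC|apply: etaC]; exists t.
by exists C; split=> _ [t tI <-]; apply: close_to_closed_nbhd;
  [apply: gC|apply: etaC].
Qed.

Lemma quasi_geodesicP l e I eta : 0 < l ->
  quasi_geodesic l e I eta <-> forall s t, s \in I -> t \in I ->
    `|s - t| <= l * (mdist (eta s) (eta t) + e) /\
    mdist (eta s) (eta t) <= l * `|s - t| + e.
Proof.
move=> l0; split=> H s t sI tI.
  by have /andP[] := H s t sI tI; rewrite lerBlDr ler_pdivrMl.
by have [H1 H2] := H s t sI tI; rewrite lerBlDr ler_pdivrMl// H1.
Qed.

Lemma quasi_geodesic_ltr l e I eta : 0 < l ->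
  (forall s t, s \in I -> t \in I -> s <= t ->
    t - s <= l * (mdist (eta s) (eta t) + e) /\
    mdist (eta s) (eta t) <= l * (t - s) + e) ->
  quasi_geodesic l e I eta.
Proof.
move=> l0 H; apply/quasi_geodesicP => // s t sI tI.
have [st|/ltW ts] := leP s t.
  by rewrite distrC ger0_norm ?subr_ge0//; exact: H.
by rewrite metric_sym ger0_norm ?subr_ge0//; exact: H.
Qed.

Lemma quasi_geodesic_perturb l e C I eta eta' : 1 <= l ->
  quasi_geodesic l e I eta ->
  (forall t, t \in I -> mdist (eta' t) (eta t) <= C) ->
  quasi_geodesic l (e + 2 * C) I eta'.
Proof.
move=> l1 /quasi_geodesicP-H etaC.
have l0 : 0 < l by lra.
apply/quasi_geodesicP => // s t sI tI; have [H1 H2] := H l0 s t sI tI.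
have := etaC _ sI; have := etaC _ tI.
have := metric_triangle (eta s) (eta' s) (eta t).
have := metric_triangle (eta' s) (eta' t) (eta t).
have := metric_triangle (eta' s) (eta s) (eta' t).
have := metric_triangle (eta s) (eta t) (eta' t).
rewrite (metric_sym (eta s) (eta' s)) (metric_sym (eta t) (eta' t)) => *.
split; last lra.
by apply: (le_trans H1); rewrite ler_pM2l//; lra.
Qed.

Lemma geodesic_quasi_geodesic I g : geodesic I g -> quasi_geodesic 1 0 I g.
Proof. by move=> gI s t sI tI; rewrite gI// invr1 mul1r subr0 addr0 lexx. Qed.

Lemma geodesic_sub I J g : {subset J <= I} -> geodesic I g -> geodesic J g.
Proof. by move=> JI gI s t /JI sI /JI tI; exact: gI. Qed.

Lemma quasi_geodesic_sub l e I J g :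
  {subset J <= I} -> quasi_geodesic l e I g -> quasi_geodesic l e J g.
Proof. by move=> JI gI s t /JI sI /JI tI; exact: gI. Qed.

(** Quasi-geodesics need not be continuous, so it is enough to move the two endpoints of [eta] onto
    [g]. A move by [C] adds [2 * C] to the additive constant. *)
Lemma morse_close M I g C l e a b eta : morse_geodesic M I g -> 0 <= C ->
  1 <= l -> 0 <= e -> a <= b -> quasi_geodesic l e `[a, b] eta ->
  close_to I g C (eta a) -> close_to I g C (eta b) ->
  forall t, t \in `[a, b] -> close_to I g (M l (e + 2 * C) + C + 1) (eta t).
Proof.
move=> [_ gM] C0 l1 e0 ab etaQ [u uI au] [v vI bv] t tab.
pose eta' t := if t == a then g u else if t == b then g v else eta t.
have eta'C s : mdist (eta' s) (eta s) <= C.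
  rewrite /eta'; case: eqP => [->|_]; first by rewrite metric_sym.
  by case: eqP => [->|_]; [rewrite metric_sym|rewrite mdistxx].
have eta'a : eta' a = g u by rewrite /eta' eqxx.
have [z zI eta'b] : exists2 z, z \in I & eta' b = g z.
  by rewrite /eta' eqxx; case: eqP => _; [exists u|exists v].
have e'0 : 0 <= e + 2 * C by lra.
have H : close_to I g (M l (e + 2 * C) + 1) (eta' t).
  apply/closed_nbhd_close_to/(gM _ _ a b) => //.
  - exact: quasi_geodesic_perturb etaQ _.
  - by exists u.
  - by exists z.
rewrite addrAC addrC; apply: close_toD H.
by rewrite metric_sym.
Qed.

(** The absolute value turns any explicit bound into a gauge without a separate proof of
    nonnegativity. *)
Definition abs_gauge (m : R -> R -> R) : morse_gauge R :=
  MorseGauge (fun l e _ _ => normr_ge0 (m l e)).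

Definition le_gauge M N :=
  forall l e, 1 <= l -> 0 <= e -> M l e <= N l e.

Lemma morse_geodesic_le M N I g :
  le_gauge M N -> morse_geodesic M I g -> morse_geodesic N I g.
Proof.
move=> MN [gI gM]; split=> // l e a b eta l1 e0 ab etaQ ga gb t tab.
apply: le_trans (gM _ _ _ _ _ l1 e0 ab etaQ ga gb _ tab) _.
by rewrite lee_fin; exact: MN.
Qed.

(** The tolerance [morse_delta] grows with the gauge, here through the term [8 * K 3 0]. Hence any
    fixed fellow-travelling bound becomes admissible after enlarging the gauge. *)
Lemma gauge_ub M N (c : R) :
  exists K, [/\ le_gauge M K, le_gauge N K & c <= morse_delta K].
Proof.
exists (abs_gauge (fun l e => `|M l e| + `|N l e| + `|c|)); split=> /=.
- move=> l e l1 e0 /=; rewrite ger0_norm ?addr_ge0//.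
  by rewrite (le_trans (ler_norm _))// -addrA lerDl addr_ge0.
- move=> l e l1 e0 /=; rewrite ger0_norm ?addr_ge0//.
  by rewrite (le_trans (ler_norm _))// addrAC lerDr addr_ge0.
- rewrite /morse_delta le_max; apply/orP; right => /=.
  rewrite ger0_norm ?addr_ge0//; have := ler_norm c.
  have := normr_ge0 c.
  have := normr_ge0 (M 3 0); have := normr_ge0 (N 3 0); lra.
Qed.

Lemma morse_of_close (m : R -> R -> R) I g : geodesic I g ->
  (forall l e a b eta s t, 1 <= l -> 0 <= e -> a <= b ->
    quasi_geodesic l e `[a, b] eta -> s \in I -> t \in I ->
    eta a = g s -> eta b = g t ->
    forall r, r \in `[a, b] -> close_to I g (m l e) (eta r)) ->
  morse_geodesic (abs_gauge m) I g.
Proof.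
move=> gI H; split=> // l e a b eta l1 e0 ab etaQ [s sI sa] [t tI tb] r rab.
apply: close_to_closed_nbhd; apply: close_to_le (ler_norm _) _.
by apply: (H _ _ a b eta s t).
Qed.

End CloseTo.

(** * Stability of the Morse property under bounded perturbation *)

Section MorseStability.
Context {R : realType} {X : metricType R}.
Implicit Types (I J : interval R) (g eta : R -> X) (M N : morse_gauge R).

Lemma choose_close J g I eta (K : R) :
  (forall r, r \in I -> close_to J g K (eta r)) ->
  exists f : R -> R, forall r, r \in I -> f r \in J /\ mdist (eta r) (g (f r)) <= K.
Proof.
move=> H; have /choice[f fP] : forall r, exists u,
    r \in I -> u \in J /\ mdist (eta r) (g u) <= K.
  by move=> r; have [/H[u uJ ru]|_] := boolP (r \in I); [exists u|exists 0].
by exists f.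
Qed.

(** As [g] is geodesic, differences of positions are distances on [g], so the coarse intermediate
    value lemmas apply to [f]. *)
Lemma nearest_point_lipschitz J g I eta f (k c K : R) : geodesic J g ->
  (forall s t, s \in I -> t \in I -> mdist (eta s) (eta t) <= k * `|s - t| + c) ->
  (forall r, r \in I -> f r \in J /\ mdist (eta r) (g (f r)) <= K) ->
  {in I &, forall x y, `|f x - f y| <= k * `|x - y| + (c + 2 * K)}.
Proof.
move=> gJ H fP x y xI yI; have [fx gx] := fP _ xI; have [fy gy] := fP _ yI.
rewrite -gJ//; have := H _ _ xI yI.
have := metric_triangle (g (f x)) (eta x) (g (f y)).
have := metric_triangle (eta x) (eta y) (g (f y)).
by rewrite (metric_sym (g (f x)) (eta x)) => *; lra.
Qed.

(* The approximating Morse geodesics may vary with the compact subsegment, so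
   this applies to limits as well as to neighbours of a fixed geodesic. *)
Lemma morse_stability M (C : R) : 0 <= C -> exists M', forall I l,
  geodesic I l ->
  (forall s t, s \in I -> t \in I -> s <= t -> exists J g,
    morse_geodesic M J g /\ forall v, v \in `[s, t] -> close_to J g C (l v)) ->
  morse_geodesic M' I l.
Proof.
move=> C0; pose K k e := M k (e + 2 * C) + C + 1.
exists (abs_gauge (fun k e => K k e + (K k e + 3 * C + 1) + C +
  (k * (k * (2 * K k e + (e + 2 * K k e + 1) + e)) + e))).
move=> I l lI H; apply: morse_of_close => // k e a b eta s t k1 e0 ab etaQ sI tI
  etaa etab r rab.
have k0 : 0 < k by lra.
have [J [g [gM lg]]] : exists J g, morse_geodesic M J g /\
    forall v, v \in `[Num.min s t, Num.max s t] -> close_to J g C (l v).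
  have [st|/ltW ts] := leP s t; first exact: H.
  exact: H.
have gJ := gM.1.
have sst : s \in `[Num.min s t, Num.max s t].
  by rewrite in_itv/= ge_min le_max lexx.
have tst : t \in `[Num.min s t, Num.max s t].
  by rewrite in_itv/= ge_min le_max lexx !orbT.
have stI v : v \in `[Num.min s t, Num.max s t] -> v \in I.
  move=> vst; apply: (@interval_is_interval _ I (Num.min s t) (Num.max s t)).
  - by case: leP.
  - by case: leP.
  - by rewrite in_itv/= in vst.
have [f fP] : exists f : R -> R, forall v, v \in `[a, b] ->
    f v \in J /\ mdist (eta v) (g (f v)) <= K k e.
  apply: choose_close => v vab; apply: morse_close vab => //.
  - by rewrite etaa; exact: lg.
  - by rewrite etab; exact: lg.
have [h hP] := choose_close lg.
have etaQ' := (quasi_geodesicP _ _ _ k0).1 etaQ.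
have e'0 : 0 <= e + 2 * C by lra.
have K0 : 0 <= K k e by have := gauge_ge0 M k1 e'0; rewrite /K; lra.
have aab : a \in `[a, b] by rewrite in_itv/= lexx.
have bab : b \in `[a, b] by rewrite in_itv/= lexx ab.
have flip : {in `[a, b] &, forall x y,
    `|f x - f y| <= k * `|x - y| + (e + 2 * K k e)}.
  apply: nearest_point_lipschitz gJ _ fP => x y xab yab.
  exact: (etaQ' _ _ xab yab).2.
have hlip : {in `[Num.min s t, Num.max s t] &, forall x y,
    `|h x - h y| <= 1 * `|x - y| + (0 + 2 * C)}.
  apply: nearest_point_lipschitz gJ _ hP => x y xst yst.
  by rewrite lI ?mul1r ?addr0//; exact: stI.
set c := e + 2 * K k e + 1; set D2 := k * (k * (2 * K k e + c + e)) + e.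
have D20 : 0 <= D2.
  rewrite /D2 addr_ge0// mulr_ge0 ?(ltW k0)// mulr_ge0 ?(ltW k0)//.
  by rewrite /c; lra.
(* If eta comes back close to an endpoint of l, then it did not go far. *)
have back x y : x \in `[a, b] -> y \in `[a, b] -> `|f x - f y| <= c ->
    `|r - y| <= `|x - y| -> mdist (eta r) (eta y) <= D2.
  move=> xab yab fxy rxy; have [fx ex] := fP _ xab; have [fy ey] := fP _ yab.
  have dxy : mdist (eta x) (eta y) <= 2 * K k e + c.
    have := metric_triangle (eta x) (g (f x)) (eta y).
    have := metric_triangle (g (f x)) (g (f y)) (eta y).
    by rewrite gJ// (metric_sym (g (f y)) (eta y)) => *; lra.
  apply: (le_trans (etaQ' _ _ rab yab).2); rewrite lerD2r ler_pM2l//.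
  apply: (le_trans rxy); apply: (le_trans (etaQ' _ _ xab yab).1).
  by rewrite ler_pM2l// lerD2r.
have [fr er] := fP _ rab.
have [wfab|[x xar fx]|[x xrb fx]] := coarse_ivt_trichotomy k0 rab flip.
(* Here [eta r] projects between the projections of the endpoints. As [f a] and [f b] are near [h s]
   and [h t], clamping [f r] between the latter moves it little, to [w]. The intermediate value
   lemma for [h] then gives a point [l v] projecting near [w]. *)
- have endp y v : y \in `[a, b] -> v \in `[Num.min s t, Num.max s t] ->
      eta y = l v -> `|f y - h v| <= K k e + C.
    move=> yab vst yv; have [fy ey] := fP _ yab; have [hv lv] := hP _ vst.
    rewrite -gJ//; have := metric_triangle (g (f y)) (eta y) (g (h v)).
    by rewrite (metric_sym (g (f y)) (eta y)) yv => *; rewrite yv in ey; lra.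
  have ea := endp _ _ aab sst etaa; have eb := endp _ _ bab tst etab.
  have [w [wh wr]] : exists w, (h s <= w <= h t \/ h t <= w <= h s) /\
      `|f r - w| <= K k e + C.
    move: ea eb wfab; rewrite !ler_norml => /andP[a1 a2] /andP[b1 b2] wfab.
    have [hst|/ltW hts] := leP (h s) (h t).
      have [rs|/ltW sr] := leP (f r) (h s).
        exists (h s); split; first by left; rewrite lexx.
        by move: wfab; case: (leP (f a) (f b)) => ? /andP[? ?]; rewrite ler_norml; lra.
      have [tr|/ltW rt] := leP (h t) (f r).
        exists (h t); split; first by left; rewrite lexx hst.
        by move: wfab; case: (leP (f a) (f b)) => ? /andP[? ?]; rewrite ler_norml; lra.
      by exists (f r); split; [left; rewrite sr|rewrite subrr normr0; lra].
    have [rs|/ltW sr] := leP (f r) (h t).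
      exists (h t); split; first by right; rewrite lexx.
      by move: wfab; case: (leP (f a) (f b)) => ? /andP[? ?]; rewrite ler_norml; lra.
    have [tr|/ltW rt] := leP (h s) (f r).
      exists (h s); split; first by right; rewrite lexx hts.
      by move: wfab; case: (leP (f a) (f b)) => ? /andP[? ?]; rewrite ler_norml; lra.
    by exists (f r); split; [right; rewrite sr|rewrite subrr normr0; lra].
  have mm : Num.min s t <= Num.max s t by case: (leP s t) => // /ltW.
  have wh' : h (Num.min s t) <= w <= h (Num.max s t) \/
             h (Num.max s t) <= w <= h (Num.min s t).
    by case: (leP s t) wh => // _ []; [right|left].
  have [v vst hw] := coarse_ivt ltr01 mm hlip wh'.
  exists v; first exact: stI.
  have [hv lv] := hP _ vst.
  have hr : mdist (g (f r)) (g (h v)) <= K k e + C + (2 * C + 1).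
    by rewrite gJ//; move: wr hw; rewrite !ler_norml; lra.
  have := metric_triangle (eta r) (g (f r)) (l v).
  have := metric_triangle (g (f r)) (g (h v)) (l v).
  by rewrite (metric_sym (g (h v))) => *; lra.
- exists t => //; rewrite -etab; apply: (@le_trans _ _ D2); last by rewrite /D2 /c; lra.
  move: (xar) (rab); rewrite !in_itv/= => /andP[? ?] /andP[? ?].
  apply: (back x) => //; first by rewrite in_itv/=; apply/andP; split; lra.
  by rewrite !ler0_norm; lra.
- exists s => //; rewrite -etaa; apply: (@le_trans _ _ D2); last by rewrite /D2 /c; lra.
  move: (xrb) (rab); rewrite !in_itv/= => /andP[? ?] /andP[? ?].
  apply: (back x) => //; first by rewrite in_itv/=; apply/andP; split; lra.
  by rewrite !ger0_norm; lra.
Qed.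

End MorseStability.

(** * Shortcuts, concatenations and triangles of Morse geodesics *)

Section Concatenation.
Context {R : realType} {X : metricType R}.
Implicit Types (I J : interval R) (g q eta xi r c : R -> X) (M N : morse_gauge R).

(** In a Cayley graph a geodesic between vertices is adjusted at its two ends by at most 1 each;
    this produces the constants 1 and 2. *)
Definition coarsely_geodesic := forall x y : X, exists (L : R) sigma,
  [/\ 0 <= L, sigma 0 = x, sigma L = y & quasi_geodesic 1 2 `[0, L] sigma].

Lemma nearest_pointP I q a x : a \in I ->
  exists2 p, p \in I & forall t, t \in I -> mdist x (q p) <= mdist x (q t) + 1.
Proof.
move=> aI; pose A := [set mdist x (q t) | t in [set` I]].
have infA : has_inf A.
  split; first by exists (mdist x (q a)), a.
  by exists 0 => _ [t _ <-]; exact: mdist_ge0.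
have [_ [p pI <-] /ltW px] := inf_adherent ltr01 infA.
exists p => // t tI; apply: (le_trans px); rewrite lerD2r.
by apply: ge_inf; [exact: infA.2|exists t].
Qed.

Lemma quasi_geodesic_rev (l e a b : R) q :
  quasi_geodesic l e `[a, b] q -> quasi_geodesic l e `[- b, - a] (q \o -%R).
Proof.
move=> qQ s t; rewrite !in_itv/= => /andP[? ?] /andP[? ?].
have := qQ (- s) (- t); rewrite -opprD normrN; apply; rewrite in_itv/=;
  by apply/andP; split; lra.
Qed.

Context (cgX : coarsely_geodesic).

(* A path followed by a geodesic from its end p to a point x is efficient as
   soon as p is nearest to x on the path. *)
Lemma quasi_geodesic_shortcut (l e a p : R) q x : 1 <= l -> 0 <= e -> a <= p ->
  quasi_geodesic l e `[a, p] q ->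
  (forall t, t \in `[a, p] -> mdist x (q p) <= mdist x (q t) + 1) ->
  exists (b : R) eta, [/\ p <= b, b - p <= mdist x (q p) + 2,
    forall t, t \in `[a, p] -> eta t = q t, eta b = x &
    quasi_geodesic (2 * l + 1) (e + 7) `[a, b] eta].
Proof.
move=> l1 e0 ap qQ near_p.
have [L [s [L0 s0 sL sQ]]] := cgX (q p) x.
have l0 : 0 < l by lra.
have qQ1 := (quasi_geodesicP _ _ _ l0).1 qQ.
have sQ1 := (quasi_geodesicP _ _ _ ltr01).1 sQ.
have in0 : 0 \in `[0, L] by rewrite in_itv/= lexx.
have inL : L \in `[0, L] by rewrite in_itv/= lexx L0.
have inp : p \in `[a, p] by rewrite in_itv/= lexx ap.
have [] := sQ1 _ _ in0 inL; rewrite s0 sL sub0r normrN ger0_norm// !mul1r.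
rewrite metric_sym => Lx xL.
exists (p + L), (fun t => if t <= p then q t else s (t - p)); split=> //.
- by rewrite lerDl.
- by rewrite addrAC subrr add0r.
- by move=> t; rewrite in_itv/= => /andP[_ ->].
- case: leP => [|_]; last by rewrite addrAC subrr add0r.
  rewrite gerDl => L0'; have L00 : L = 0 by lra.
  by rewrite L00 addr0 -sL L00 s0.
apply: quasi_geodesic_ltr; first lra.
move=> u v; rewrite !in_itv/= => /andP[au ub] /andP[av vb] uv.
have [vp|pv] := leP v p.
  have up : u <= p by lra.
  rewrite up; have [||] := qQ1 u v; rewrite ?in_itv/= ?au ?av ?up ?vp//.
  rewrite distrC ger0_norm ?subr_ge0// => H1 H2.
  have := mdist_ge0 (q u) (q v) => d0; split; first by nra.
  by apply: (le_trans H2); nra.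
have sv : v - p \in `[0, L] by rewrite in_itv/=; apply/andP; split; lra.
have [up|pu] := leP u p; last first.
  have su : u - p \in `[0, L] by rewrite in_itv/=; apply/andP; split; lra.
  have [] := sQ1 _ _ su sv; rewrite !mul1r distrC ger0_norm; last lra.
  move=> H1 H2; have := mdist_ge0 (s (u - p)) (s (v - p)) => d0.
  by split; nra.
have uap : u \in `[a, p] by rewrite in_itv/= au up.
have xu := near_p _ uap.
have [] := sQ1 _ _ in0 sv; rewrite s0 !mul1r sub0r normrN ger0_norm; last lra.
move=> H1 H2; have [] := sQ1 _ _ sv inL; rewrite sL !mul1r distrC ger0_norm; last lra.
move=> H3 H4; have [] := qQ1 _ _ uap inp; rewrite distrC ger0_norm; last lra.
move=> H5 H6.
have := metric_triangle (q u) (q p) (s (v - p)).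
have T2 := metric_triangle x (s (v - p)) (q u).
have T3 := metric_triangle (q u) (s (v - p)) (q p).
rewrite (metric_sym (s (v - p)) (q p)) in T3.
rewrite (metric_sym x (s (v - p))) (metric_sym (s (v - p)) (q u)) in T2.
set d := mdist (q u) (s (v - p)) in T2 T3 *.
move=> T1; have d0 : 0 <= d by exact: mdist_ge0.
split; last by nra.
(* As [p] is nearest up to 1, [L - 2 <= mdist x (q p) <= mdist x (q u) + 1], and the last distance
   is at most [L - (v - p) + 2 + d]. This is the 5; the path from [q u] through [s (v - p)] back to
   [q p] then gives the 7. *)
have vd : v - p <= d + 5 by lra.
have qd : mdist (q u) (q p) + e <= 2 * d + 7 + e by lra.
have : p - u <= l * (2 * d + 7 + e).
  by apply: (le_trans H5); rewrite ler_pM2l.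
by nra.
Qed.

(** The end of [q] at [p] may be far from [g], so the Morse property cannot be applied to [q]
    itself. Continued from [q p] to [x], it becomes a quasi-geodesic with both ends near [g]. *)
Lemma morse_shortcut M I g (C l e a p : R) q x : morse_geodesic M I g ->
  0 <= C -> 1 <= l -> 0 <= e -> a <= p -> quasi_geodesic l e `[a, p] q ->
  close_to I g C (q a) -> close_to I g C x ->
  (forall t, t \in `[a, p] -> mdist x (q p) <= mdist x (q t) + 1) ->
  forall t, t \in `[a, p] ->
    close_to I g (M (2 * l + 1) (e + 7 + 2 * C) + C + 1) (q t).
Proof.
move=> gM C0 l1 e0 ap qQ ga gx near_p t tap.
have [b [eta [pb _ etaq etab etaQ]]] :=
  quasi_geodesic_shortcut l1 e0 ap qQ near_p.
rewrite -etaq//; apply: morse_close etaQ _ _ _ _ => //; [lra|lra|lra| | |].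
- by rewrite etaq// in_itv/= lexx.
- by rewrite etab.
- by move: tap; rewrite !in_itv/= => /andP[-> tp]; exact: le_trans pb.
Qed.

Lemma morse_shortcut_rev M I g (C l e p b : R) q x : morse_geodesic M I g ->
  0 <= C -> 1 <= l -> 0 <= e -> p <= b -> quasi_geodesic l e `[p, b] q ->
  close_to I g C (q b) -> close_to I g C x ->
  (forall t, t \in `[p, b] -> mdist x (q p) <= mdist x (q t) + 1) ->
  forall t, t \in `[p, b] ->
    close_to I g (M (2 * l + 1) (e + 7 + 2 * C) + C + 1) (q t).
Proof.
move=> gM C0 l1 e0 pb qQ gb gx near_p t tpb.
have rev s : (- s \in `[- b, - p]) = (s \in `[p, b]).
  by rewrite !in_itv/= !lerN2 andbC.
have := @morse_shortcut M I g C l e (- b) (- p) (q \o -%R) x gM C0 l1 e0.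
rewrite lerN2 /= !opprK => /(_ pb (quasi_geodesic_rev qQ) gb gx).
move=> /(_ _ (- t)); rewrite opprK rev; apply => // s.
by rewrite -{1}[s]opprK rev => /near_p.
Qed.

(** Each part of [g] on one side of [u] is Morse by [morse_stability]. A quasi-geodesic with ends on
    [g] is cut at its point nearest to [g u], and each piece, shortcut to [g u], has both ends on a
    single part. *)
Lemma morse_geodesic_cat M (C : R) : 0 <= C ->
  exists M', forall I g u J1 g1 J2 g2, geodesic I g -> u \in I ->
    morse_geodesic M J1 g1 -> morse_geodesic M J2 g2 ->
    (forall v, v \in I -> v <= u -> close_to J1 g1 C (g v)) ->
    (forall v, v \in I -> u <= v -> close_to J2 g2 C (g v)) ->
    morse_geodesic M' I g.
Proof.
move=> C0; have [N NP] := morse_stability (X := X) M C0.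
exists (abs_gauge (fun l e => N (2 * l + 1) (e + 7 + 2 * 0) + 0 + 1)).
move=> I g u J1 g1 J2 g2 gI uI g1M g2M close1 close2.
have sub s v : s \in I ->
    v \in `[Num.min s u, Num.max s u] -> v \in I.
  move=> sI vsu; apply: (@interval_is_interval _ I (Num.min s u) (Num.max s u)).
  - by case: (leP s u).
  - by case: (leP s u).
  - by rewrite in_itv/= in vsu.
have half s : s \in I -> morse_geodesic N `[Num.min s u, Num.max s u] g.
  move=> sI; apply: NP.
    by move=> x y /(sub _ _ sI) xI /(sub _ _ sI) yI; exact: gI.
  move=> x y xsu ysu xy; have [su|us] := leP s u.
    exists J1, g1; split=> // v vxy; apply: close1.
      apply: (sub s) => //; move: xsu ysu vxy; rewrite !in_itv/=.
      by case: (leP s u) => ? /andP[? ?] /andP[? ?] /andP[? ?];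
        apply/andP; split; lra.
    by move: xsu ysu vxy; rewrite !in_itv/=;
      case: (leP s u) => ? /andP[? ?] /andP[? ?] /andP[? ?]; lra.
  exists J2, g2; split=> // v vxy; apply: close2.
    apply: (sub s) => //; move: xsu ysu vxy; rewrite !in_itv/=.
    by case: (leP s u) => ? /andP[? ?] /andP[? ?] /andP[? ?];
      apply/andP; split; lra.
  by move: xsu ysu vxy; rewrite !in_itv/=;
    case: (leP s u) => ? /andP[? ?] /andP[? ?] /andP[? ?]; lra.
apply: morse_of_close => // l e a b eta s t l1 e0 ab etaQ sI tI etaa etab r rab.
have ain : a \in `[a, b] by rewrite in_itv/= lexx ab.
have [p pab near_p] := nearest_pointP eta (g u) ain.
move: (pab) (rab); rewrite !in_itv/= => /andP[ap pb] /andP[ar rb].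
have endp x : x \in `[Num.min x u, Num.max x u].
  by rewrite in_itv/= ge_min le_max lexx.
have uin x : u \in `[Num.min x u, Num.max x u].
  by rewrite in_itv/= ge_min le_max lexx !orbT.
have self x y : x \in `[Num.min y u, Num.max y u] ->
    close_to `[Num.min y u, Num.max y u] g 0 (g x).
  by exists x => //; rewrite mdistxx.
have [rp|/ltW pr] := leP r p.
  have [v /(sub _ _ sI) vI rv] : close_to `[Num.min s u, Num.max s u] g
      (N (2 * l + 1) (e + 7 + 2 * 0) + 0 + 1) (eta r); last by exists v.
  apply: (morse_shortcut (half _ sI) (lexx 0) l1 e0 ap
    (quasi_geodesic_sub _ etaQ) _ (self _ _ (uin s)) _).
  - by move=> x; rewrite !in_itv/= => /andP[-> /le_trans->].
  - by rewrite etaa; exact: self.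
  - move=> x; rewrite in_itv/= => /andP[ax xp].
    by apply: near_p; rewrite in_itv/= ax (le_trans xp).
  - by rewrite in_itv/= ar rp.
have [v /(sub _ _ tI) vI rv] : close_to `[Num.min t u, Num.max t u] g
    (N (2 * l + 1) (e + 7 + 2 * 0) + 0 + 1) (eta r); last by exists v.
apply: (morse_shortcut_rev (half _ tI) (lexx 0) l1 e0 pb
  (quasi_geodesic_sub _ etaQ) _ (self _ _ (uin t)) _).
- move=> x; rewrite !in_itv/= => /andP[px ->].
  by rewrite (le_trans ap).
- by rewrite etab; exact: self.
- move=> x; rewrite in_itv/= => /andP[px xb].
  by apply: near_p; rewrite in_itv/= xb (le_trans ap).
- by rewrite in_itv/= pr rb.
Qed.

(** In a triangle with third corner [y] and two Morse sides, the remaining side [g] is cut at its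
    point nearest to [y]. Shortcuts to [y] keep one piece near [al] and the other near [be], and
    [morse_geodesic_cat] applies. *)
Lemma morse_triangle M (C : R) : 0 <= C ->
  exists M', forall I J al be (a b : R) g y, a <= b -> geodesic `[a, b] g ->
    morse_geodesic M I al -> morse_geodesic M J be ->
    close_to I al C y -> close_to J be C y ->
    close_to I al C (g a) -> close_to J be C (g b) ->
    morse_geodesic M' `[a, b] g.
Proof.
move=> C0; pose K := M (2 * 1 + 1) (0 + 7 + 2 * C) + C + 1.
have K0 : 0 <= K.
  have := @gauge_ge0 _ M (2 * 1 + 1) (0 + 7 + 2 * C).
  by rewrite /K => /(_ ltac:(lra) ltac:(lra)); lra.
have [N NP] := morse_geodesic_cat M K0.
exists N => I J al be a b g y ab gab alM beM yal ybe ala beb.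
have ain : a \in `[a, b] by rewrite in_itv/= lexx ab.
have [p pab near_p] := nearest_pointP g y ain.
move: (pab); rewrite in_itv/= => /andP[ap pb].
have gQ := geodesic_quasi_geodesic gab.
apply: (NP _ _ _ _ _ _ _ gab pab alM beM) => v; rewrite in_itv/= => /andP[av vb] pv.
  apply: (morse_shortcut alM C0 (lexx 1) (lexx 0) ap
    (quasi_geodesic_sub _ gQ) ala yal _) => //.
  - by move=> x; rewrite !in_itv/= => /andP[-> /le_trans->].
  - move=> x; rewrite in_itv/= => /andP[ax xp].
    by apply: near_p; rewrite in_itv/= ax (le_trans xp).
  - by rewrite in_itv/= av pv.
apply: (morse_shortcut_rev beM C0 (lexx 1) (lexx 0) pb
  (quasi_geodesic_sub _ gQ) beb ybe _) => //.
- move=> x; rewrite !in_itv/= => /andP[px ->].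
  by rewrite (le_trans ap).
- move=> x; rewrite in_itv/= => /andP[px xb].
  by apply: near_p; rewrite in_itv/= xb (le_trans ap).
- by rewrite in_itv/= pv vb.
Qed.

End Concatenation.

(** * Geodesic rays at finite Hausdorff distance *)

Section Rays.
Context {R : realType} {X : metricType R}.
Implicit Types (I J : interval R) (g q eta xi r c : R -> X) (M N : morse_gauge R).

(** Parameters are distances from the common origin, so the parameter [u] of a point of [xi] near
    [r t] differs from [t] by at most [D]. *)
Lemma synchronize I J r xi (D t : R) : geodesic I r -> geodesic J xi ->
  0 \in I -> 0 \in J -> t \in I -> t \in J -> 0 <= t ->
  (forall u, u \in J -> 0 <= u) -> r 0 = xi 0 ->
  close_to J xi D (r t) -> mdist (r t) (xi t) <= 2 * D.
Proof.
move=> rI xiJ I0 J0 tI tJ t0 J_ge0 r0 [u uJ ru]; have u0 := J_ge0 _ uJ.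
have rt := rI _ _ I0 tI; have xiu := xiJ _ _ J0 uJ; have xitu := xiJ _ _ tJ uJ.
rewrite sub0r normrN ger0_norm// r0 in rt.
rewrite sub0r normrN ger0_norm// in xiu.
have := metric_triangle (xi 0) (r t) (xi u).
have := metric_triangle (xi 0) (xi u) (r t).
have := metric_triangle (r t) (xi u) (xi t).
rewrite (metric_sym (xi u) (r t)) (metric_sym (xi u) (xi t)) xitu => *.
have : `|t - u| <= D by rewrite ler_norml; lra.
lra.
Qed.

Lemma morse_ray_of_segments M : exists M', forall r, geodesic `[0, +oo[ r ->
  (forall B : R, exists2 b, B <= b & morse_geodesic M `[0, b] r) ->
  morse_geodesic M' `[0, +oo[ r.
Proof.
have [N NP] := morse_stability (X := X) M (lexx 0).
exists N => r rg H; apply: NP => // s t.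
rewrite !in_itv/= !andbT => s0 t0 st; have [b tb rb] := H t.
exists `[0, b], r; split=> // v; rewrite in_itv/= => /andP[sv vt].
exists v; last by rewrite mdistxx.
by rewrite in_itv/=; apply/andP; split; lra.
Qed.

Lemma close_rays_hausdorff (C : R) r xi : geodesic `[0, +oo[ r ->
  geodesic `[0, +oo[ xi ->
  (forall t, t \in `[0, +oo[ -> close_to `[0, +oo[ xi C (r t)) ->
  exists D, forall t, t \in `[0, +oo[ -> close_to `[0, +oo[ r D (xi t).
Proof.
move=> rg xig H; have [f fP] := choose_close H.
have z0 : (0 : R) \in `[0, +oo[ by rewrite in_itv/= lexx.
have [f0 rf0] := fP _ z0; have C0 : 0 <= C := le_trans (mdist_ge0 _ _) rf0.
have f0' := f0; rewrite in_itv/= andbT in f0'.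
exists (f 0 + 3 * C + 1) => t t0; have t0' := t0; rewrite in_itv/= andbT in t0'.
have [tf|/ltW ft] := leP t (f 0).
  exists 0 => //; have := metric_triangle (xi t) (xi (f 0)) (r 0).
  by rewrite (metric_sym (xi (f 0)) (r 0)) xig// distrC ger0_norm ?subr_ge0//; lra.
(* Large enough that [f b >= t]: positions move by at least [b - 2 * C] between times 0 and [b], and
   they are nonnegative. The value [t] is then nearly attained by [f]. *)
pose b := t + f 0 + 2 * C.
have b0 : 0 <= b by rewrite /b; lra.
have bI : b \in `[0, +oo[ by rewrite in_itv/= b0.
have [fb rfb] := fP _ bI; have fb' := fb; rewrite in_itv/= andbT in fb'.
have tfb : t <= f b.
  have := metric_triangle (r 0) (xi (f 0)) (r b).
  have := metric_triangle (xi (f 0)) (xi (f b)) (r b).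
  rewrite (metric_sym (xi (f b)) (r b)) rg// xig// sub0r normrN (ger0_norm b0).
  have bE : b = t + f 0 + 2 * C by [].
  have [|] := leP (f 0) (f b); last first.
    by move=> /ltW ?; rewrite ger0_norm ?subr_ge0//; lra.
  by move=> ?; rewrite distrC ger0_norm ?subr_ge0//; lra.
have flip : {in `[0, b] &, forall x y, `|f x - f y| <= 1 * `|x - y| + (0 + 2 * C)}.
  have sub x : x \in `[0, b] -> x \in `[0, +oo[.
    by rewrite !in_itv/= andbT => /andP[].
  apply: (nearest_point_lipschitz (eta := r) xig) => [s u sb ub|s /sub/fP//].
  by rewrite rg ?mul1r ?addr0//; exact: sub.
have [|x xb fx] := @coarse_ivt _ f 0 b (0 + 2 * C) 1 t ltr01 b0 flip.
  by left; rewrite ft.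
have xI : x \in `[0, +oo[ by move: xb; rewrite !in_itv/= andbT => /andP[].
exists x => //; have [fxI rfx] := fP _ xI.
have := metric_triangle (xi t) (xi (f x)) (r x).
by rewrite (metric_sym (xi (f x)) (r x)) xig// distrC; lra.
Qed.

Lemma fellow_travel M (C : R) : 0 <= C -> exists D M', 0 <= D /\
  forall I s g b, 0 <= b -> geodesic `[0, b] g -> morse_geodesic M I s ->
    0 \in I -> (forall u, u \in I -> 0 <= u) -> g 0 = s 0 ->
    close_to I s C (g b) ->
    morse_geodesic M' `[0, b] g /\
    forall t, t \in `[0, b] -> t \in I -> mdist (g t) (s t) <= D.
Proof.
move=> C0; pose D := M 1 (0 + 2 * C) + C + 1.
have D0 : 0 <= D.
  by have := @gauge_ge0 _ M 1 (0 + 2 * C) (lexx 1); rewrite /D => /(_ ltac:(lra)); lra.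
have [N NP] := morse_stability (X := X) M D0.
exists (2 * D), N; split; first lra.
move=> I s g b b0 gb sM I0 I_ge0 g0 gbC.
have b0I : 0 \in `[0, b] by rewrite in_itv/= lexx.
have close t : t \in `[0, b] -> close_to I s D (g t).
  apply: (morse_close sM C0 (lexx 1) (lexx 0) b0 (geodesic_quasi_geodesic gb)) => //.
  by exists 0 => //; rewrite g0 mdistxx.
split.
  apply: NP => // x y xb yb xy; exists I, s; split=> // v vxy; apply: close.
  move: xb yb vxy; rewrite !in_itv/= => /andP[? ?] /andP[? ?] /andP[? ?].
  by apply/andP; split; lra.
move=> t tb tI; apply: (synchronize gb sM.1) => //; last exact: close.
exact: I_ge0.
Qed.

Context (cgX : coarsely_geodesic (X := X)).

(** The point is that [K] depends on [M] only, not on [C]. The path from [c 0] to its foot on [r],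
    along [r], and then to a distant [c T] is made by two successive shortcuts, so its constants are
    7 and 14 whatever [C] is; [C] only affects how large [T] must be. *)
Lemma asymptotic_close M : exists K, 0 <= K /\ forall r c,
  geodesic `[0, +oo[ r -> morse_geodesic M `[0, +oo[ c ->
  (exists C, forall t, t \in `[0, +oo[ -> close_to `[0, +oo[ r C (c t)) ->
  exists2 u0, 0 <= u0 & forall u, u0 <= u -> close_to `[0, +oo[ c K (r u).
Proof.
pose K := M (2 * (2 * 1 + 1) + 1) (0 + 7 + 7 + 2 * 0) + 0 + 1.
exists K; split.
  have := @gauge_ge0 _ M (2 * (2 * 1 + 1) + 1) (0 + 7 + 7 + 2 * 0).
  by rewrite /K => /(_ ltac:(lra) ltac:(lra)); lra.
move=> r c rg cM [C cC].
have z0 : (0 : R) \in `[0, +oo[ by rewrite in_itv/= lexx.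
have C0 : 0 <= C.
  by have [v _] := cC _ z0; apply: le_trans; exact: mdist_ge0.
have [u0 u0I near_u0] := nearest_pointP r (c 0) z0.
have u00 : 0 <= u0 by rewrite in_itv/= andbT in u0I.
exists u0 => // u u0u.
pose L := mdist (c 0) (r u0) + 2; pose d0 := mdist (c 0) (r 0).
have L0 : 0 <= L by rewrite /L; have := mdist_ge0 (c 0) (r u0); lra.
have d00 : 0 <= d0 by exact: mdist_ge0.
(* The summand [C + d0 + u] forces [u <= b]. Below, [eta] runs back along [r] from [r b] to [r u0]
   and then to [c 0]. Its points after [- u] are within [3 * (u + L) + 7] of [c 0], while [eta p] is
   within [C + 1] of [c T]; the remaining summands therefore force [p <= - u]. *)
pose T := C + d0 + u + (C + 1 + 3 * (u + L) + 8).
have TI : T \in `[0, +oo[ by rewrite in_itv/= andbT /T; lra.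
have [b bI cTb] := cC _ TI.
have b0 : 0 <= b by rewrite in_itv/= andbT in bI.
have T0 : mdist (c T) (c 0) = T.
  by rewrite cM.1// subr0 ger0_norm//; rewrite in_itv/= andbT in TI.
have ub : u <= b.
  have := metric_triangle (c T) (r b) (c 0).
  have := metric_triangle (r b) (r 0) (c 0).
  rewrite T0 rg// subr0 (ger0_norm b0) (metric_sym (r 0) (c 0)) -/d0 /T; lra.
have bu0 : - b <= - u0 by lra.
have sub : {subset `[u0, b] <= `[0, +oo[}.
  by move=> x; rewrite !in_itv/= andbT => /andP[? ?]; lra.
have rQ := quasi_geodesic_rev (geodesic_quasi_geodesic (geodesic_sub sub rg)).
have nearm t : t \in `[- b, - u0] ->
    mdist (c 0) ((r \o -%R) (- u0)) <= mdist (c 0) ((r \o -%R) t) + 1.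
  rewrite in_itv/= opprK => /andP[? ?]; apply: near_u0.
  by rewrite in_itv/= andbT; lra.
have [b' [eta [u0b' b'u0 etar etab' etaQ]]] :=
  quasi_geodesic_shortcut cgX (lexx 1) (lexx 0) bu0 rQ nearm.
rewrite /= opprK in b'u0.
have bin : - b \in `[- b, b'] by rewrite in_itv/= lexx; lra.
have [p pin near_p] := nearest_pointP eta (c T) bin.
have cTp : mdist (c T) (eta p) <= C + 1.
  apply: (le_trans (near_p _ bin)); rewrite lerD2r etar/= ?opprK//.
  by rewrite in_itv/= lexx.
have b'in : b' \in `[- b, b'] by rewrite in_itv/= lexx andbT; lra.
have l0 : (0 : R) < 2 * 1 + 1 by lra.
have pu : p <= - u.
  rewrite leNgt; apply/negP => up.
  have [_] := (quasi_geodesicP _ _ _ l0).1 etaQ _ _ pin b'in; rewrite etab'.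
  have pb' : p <= b' by move: pin; rewrite in_itv/= => /andP[].
  rewrite distrC ger0_norm ?subr_ge0//.
  have := metric_triangle (c T) (eta p) (c 0); rewrite T0.
  move: b'u0; rewrite -[_ + 2]/L /T; lra.
have pb' : p <= b' by lra.
have close := @morse_shortcut_rev _ _ cgX M `[0, +oo[ c 0 (2 * 1 + 1) (0 + 7)
  p b' eta (c T) cM (lexx 0).
have -> : r u = eta (- u).
  by rewrite etar/= ?opprK// in_itv/=; apply/andP; split; lra.
apply: close => //; [lra| | | | |].
- apply: quasi_geodesic_sub etaQ => x; move: pin.
  by rewrite !in_itv/= => /andP[? ?] /andP[? ?]; apply/andP; split; lra.
- by rewrite etab'; exists 0 => //; rewrite mdistxx.
- by exists T => //; rewrite mdistxx.
- move=> t; move: pin; rewrite in_itv/= => /andP[? ?] tin; apply: near_p.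
  by move: tin; rewrite !in_itv/= => /andP[? ?]; apply/andP; split; lra.
- by rewrite in_itv/=; apply/andP; split; lra.
Qed.

(** By [asymptotic_close], late points of [r] are within a distance of [xi] that depends on [M]
    only; [fellow_travel] on longer and longer initial segments then gives uniform bounds. *)
Lemma fellow_rays M : exists D M', 0 <= D /\ forall r xi,
  geodesic `[0, +oo[ r -> morse_geodesic M `[0, +oo[ xi -> r 0 = xi 0 ->
  finite_hausdorff_dist (r @` `[0, +oo[) (xi @` `[0, +oo[) ->
  (forall t, 0 <= t -> mdist (r t) (xi t) <= D) /\
  morse_geodesic M' `[0, +oo[ r.
Proof.
have [K [K0 KP]] := asymptotic_close M.
have [D [N [D0 ND]]] := fellow_travel M K0.
have [N' N'P] := morse_ray_of_segments N.
exists D, N'; split=> // r xi rg xiM r0 /finite_hausdorff_distP[C [_ rC]].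
have [u0 u00 close] := KP _ _ rg xiM (ex_intro _ C rC).
have seg b : u0 <= b -> morse_geodesic N `[0, b] r /\
    forall t, t \in `[0, b] -> t \in `[0, +oo[ -> mdist (r t) (xi t) <= D.
  move=> u0b; apply: ND => //; first exact: le_trans u0b.
  - by apply: geodesic_sub rg => x; rewrite !in_itv/= andbT => /andP[].
  - by rewrite in_itv/= lexx.
  - by move=> u; rewrite in_itv/= andbT.
  - exact: close.
split=> [t t0|].
  have [_] := seg (Num.max t u0) ltac:(by rewrite le_max lexx orbT).
  by apply; rewrite in_itv/= t0//= le_max lexx.
apply: N'P => // B; exists (Num.max B u0); first by rewrite le_max lexx.
by apply: (seg _ _).1; rewrite le_max lexx orbT.
Qed.

End Rays.

(** * Cayley graphs *)

Section WordLength.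
Context {G : fg_group}.
Implicit Types (g h k : G) (w : seq G).

Definition is_word w := all (fun a => (a \in fg_gens G) || (a^-1%g \in fg_gens G)) w.

Lemma word_exists g :
  exists n, `[< exists w, [/\ is_word w, size w = n & g = (\prod_(a <- w) a)%g] >].
Proof. by have [w wS ->] := fg_gensP g; exists (size w); apply/asboolP; exists w. Qed.

Definition word_length g : nat := ex_minn (word_exists g).

Lemma word_lengthP g :
  exists w, [/\ is_word w, size w = word_length g & g = (\prod_(a <- w) a)%g].
Proof. by rewrite /word_length; case: ex_minnP => n /asboolP. Qed.

Lemma word_length_min w : is_word w -> (word_length (\prod_(a <- w) a)%g <= size w)%N.
Proof.
rewrite /word_length; case: ex_minnP => n _ nmin wS.
by apply: nmin; apply/asboolP; exists w.
Qed.

Lemma word_lengthM g h : (word_length (g * h)%g <= word_length g + word_length h)%N.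
Proof.
have [u [uS <- gu]] := word_lengthP g; have [v [vS <- hv]] := word_lengthP h.
rewrite -size_cat gu hv.
have <- : (\prod_(a <- u ++ v) a = \prod_(a <- u) a * \prod_(a <- v) a)%g.
  elim: u {uS gu} => [|a u IH]; first by rewrite big_nil mul1g.
  by rewrite /= !big_cons IH mulgA.
by apply: word_length_min; rewrite /is_word all_cat; apply/andP.
Qed.

Lemma word_length_adjacent k g h :
  adjacent g h -> (word_length (k^-1 * h)%g <= (word_length (k^-1 * g)%g).+1)%N.
Proof.
move=> /andP[_ gh]; have -> : (k^-1 * h = (k^-1 * g) * (g^-1 * h))%g.
  by rewrite mulgA mulgK.
apply: (leq_trans (word_lengthM _ _)); rewrite -addn1 leq_add2l.
have <- : (\prod_(a <- [:: g^-1 * h]) a = g^-1 * h)%g.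
  by rewrite big_cons big_nil mulg1.
by apply: word_length_min; rewrite /is_word /= andbT invgM invgK.
Qed.

Fixpoint word_ball (n : nat) : seq G :=
  if n is m.+1 then
    let B := word_ball m in
    B ++ [seq (a * g)%g | a <- fg_gens G ++ [seq a^-1%g | a <- fg_gens G], g <- B]
  else [:: 1%g].

Lemma mem_word_ball n g : (word_length g <= n)%N -> g \in word_ball n.
Proof.
have [w [wS <- ->]] := word_lengthP g; elim: n w wS => [|n IH] [|a w] //=.
- by rewrite big_nil mem_head.
- by move=> _ _; rewrite mem_cat (IH [::]).
move=> /andP[aS wS] wn; rewrite mem_cat big_cons; apply/orP; right.
apply/allpairsP; exists (a, (\prod_(b <- w) b)%g); split=> //=; last exact: IH.
rewrite mem_cat; case/orP: aS => [->//|aS]; apply/orP; right.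
by apply/mapP; exists a^-1%g => //; rewrite invgK.
Qed.

End WordLength.

Section CayleyGeometry.
Context {R : realType} {G : fg_group}.
Local Notation X := (cayley_graph R G).
Implicit Types (g h k : G) (x y : X) (s t : R).

Lemma mdist_cayley x y l : edge_path (coords x) (coords y) l -> mdist x y <= l.
Proof. by move=> xyl; apply: ge_inf => //; exact: (path_lengths_has_inf x y).2. Qed.

Lemma sum_edge_point (f : G -> R) g h t (B : seq G) :
  uniq B -> g \in B -> h \in B ->
  \sum_(x <- B) edge_point g h t x * f x = (1 - t) * f g + t * f h.
Proof.
move=> Bu gB hB.
have pick (c : R) k : k \in B -> \sum_(x <- B) c * (x == k)%:R * f x = c * f k.
  move=> kB; rewrite (bigD1_seq k)//= eqxx mulr1 big1 ?addr0// => x /negbTE->.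
  by rewrite mulr0 mul0r.
rewrite /edge_point -!pick// -big_split/=; apply: eq_bigr => x _.
by rewrite mulrDl.
Qed.

(* A function that is 1-Lipschitz along edges extends to a 1-Lipschitz function
   on the graph by barycentric interpolation, that is to w |-> \sum_x w x * f x;
   finite sums over large enough B avoid supports. *)
Lemma edge_path_potential (f : G -> R) v w l :
  (forall g h, adjacent g h -> `|f g - f h| <= 1) ->
  edge_path v w l -> exists A : seq G, forall B, uniq B -> {subset A <= B} ->
    `|\sum_(x <- B) v x * f x - \sum_(x <- B) w x * f x| <= l.
Proof.
move=> f1; elim=> {v w l} [w|g h s t w l gh s01 t01 _ [A AP]].
  by exists [::] => B _ _; rewrite subrr normr0.
exists [:: g, h & A] => B Bu AB.
have gB : g \in B by apply: AB; rewrite mem_head.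
have hB : h \in B by apply: AB; rewrite !inE eqxx orbT.
have {}AB : {subset A <= B} by move=> x xA; apply: AB; rewrite !inE xA !orbT.
apply: (le_trans (ler_distD (\sum_(x <- B) edge_point g h t x * f x) _ _)).
apply: lerD (AP _ Bu AB); rewrite !sum_edge_point//.
have -> : (1 - s) * f g + s * f h - ((1 - t) * f g + t * f h) =
  (s - t) * (f h - f g) by ring.
by rewrite normrM ler_piMr// distrC f1.
Qed.

(** The word distance to [g] is a potential changing by at most 1 along edges, so
    [edge_path_potential] bounds the length of every path from [g] to [h] below. *)
Lemma mdist_vertex_ge g h :
  (word_length (g^-1 * h)%g)%:R <= mdist (vertex R g) (vertex R h).
Proof.
apply: lb_le_inf; first exact: path_lengths_neq0.
move=> l ghl; pose f k : R := (word_length (g^-1 * k)%g)%:R.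
have [|A AP] := @edge_path_potential f _ _ _ _ ghl.
  have f1 a b : adjacent a b -> f b - f a <= 1.
    by move=> /(word_length_adjacent g); rewrite lerBlDr nat1r ler_nat.
  by move=> a b ab; rewrite ler_norml; have := f1 _ _ ab;
    have := f1 b a; rewrite adjacent_sym ab => /(_ isT); lra.
have := AP (undup [:: g, h & A]) (undup_uniq _).
rewrite !sum_edge_point ?undup_uniq ?mem_undup ?inE ?eqxx ?orbT//.
have fg : f g = 0.
  rewrite /f mulVg; have := @word_length_min G [::] isT.
  by rewrite big_nil leqn0 => /eqP->.
have fE : f h = (word_length (g^-1 * h)%g)%:R by [].
rewrite fg subr0 !mul0r !mulr0 !mul1r !addr0 sub0r normrN fE normr_nat; apply.
by move=> x xA; rewrite mem_undup !inE xA !orbT.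
Qed.

Definition edge g h t : X :=
  if pselect (on_cayley_graph (edge_point g h t)) is left gh then CayleyPoint gh
  else vertex R g.

Lemma coords_edge g h t : (g == h) || adjacent g h -> 0 <= t <= 1 ->
  coords (edge g h t) = edge_point g h t.
Proof.
move=> gh t01; rewrite /edge; case: pselect => // -[]; by exists g, h, t.
Qed.

Lemma coords_inj : injective (@coords R G).
Proof.
move=> [x xP] [y yP] /= xy; move: yP; rewrite -xy => yP.
by congr CayleyPoint; exact: Prop_irrelevance.
Qed.

Lemma edge0 g h : (g == h) || adjacent g h -> edge g h 0 = vertex R g.
Proof. by move=> gh; apply: coords_inj; rewrite coords_edge ?lexx ?ler01// edge_point0. Qed.

Lemma edge1 g h : (g == h) || adjacent g h -> edge g h 1 = vertex R h.
Proof. by move=> gh; apply: coords_inj; rewrite coords_edge ?lexx ?ler01// edge_point1. Qed.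

Lemma mdist_edge g h s t : (g == h) || adjacent g h -> 0 <= s <= 1 -> 0 <= t <= 1 ->
  mdist (edge g h s) (edge g h t) <= `|s - t|.
Proof.
move=> gh s01 t01; case/orP: (gh) => [/eqP gh'|adj].
  have -> : edge g h s = edge g h t.
    by apply: coords_inj; rewrite !coords_edge// -gh' edge_pointxx [RHS]edge_pointxx.
  by rewrite mdistxx.
apply: mdist_cayley; rewrite !coords_edge// -[`|_|]addr0.
by apply: edge_path_cons => //; exact: edge_path_nil.
Qed.

Lemma edgeP x : exists g h t,
  [/\ (g == h) || adjacent g h, 0 <= t <= 1 & x = edge g h t].
Proof.
have [g [h [t [gh t01 xE]]]] := coordsP x; exists g, h, t; split=> //.
by apply: coords_inj; rewrite coords_edge.
Qed.

Lemma close_vertex x : exists g, mdist x (vertex R g) <= 1.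
Proof.
have [g [h [t [gh t01 ->]]]] := edgeP x; exists g.
rewrite -(edge0 gh); apply: le_trans (mdist_edge gh t01 _) _.
  by rewrite lexx ler01.
by move/andP: t01 => [? ?]; rewrite subr0 ger0_norm.
Qed.

Lemma word_lipschitz_path g w : is_word w -> exists f : R -> X,
  [/\ f 0 = vertex R g, f (size w)%:R = vertex R (g * \prod_(a <- w) a)%g &
      forall s t, 0 <= s -> s <= t -> t <= (size w)%:R ->
        mdist (f s) (f t) <= t - s].
Proof.
elim: w g => [|a w IH] g /=.
  move=> _; exists (fun=> vertex R g); split=> //; first by rewrite big_nil mulg1.
  by move=> s t _ st _; rewrite mdistxx subr_ge0.
move=> /andP[aS /(IH (g * a)%g)[f [f0 fw fl]]].
have ga : (g == g * a)%g || adjacent g (g * a)%g.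
  rewrite /adjacent; case: eqVneq => //= _.
  by rewrite mulKg invgM mulgVK.
exists (fun t => if t <= 1 then edge g (g * a)%g t else f (t - 1)); split.
- by rewrite ler01 edge0.
- rewrite big_cons mulgA -natr1 addrK -fw; case: leP => //.
  rewrite gerDr lern0 => /eqP ->; by rewrite add0r edge1// f0.
move=> s t s0 st; rewrite -natr1 => tw.
have [t1|t1] := leP t 1.
  have s1 : s <= 1 by lra.
  rewrite s1 (le_trans (mdist_edge ga _ _))//; first by rewrite s0.
    by rewrite t1 andbT; lra.
  by rewrite distrC ger0_norm ?subr_ge0.
have [s1|s1] := leP s 1; last first.
  by apply: (le_trans (fl (s - 1) (t - 1) _ _ _)); lra.
apply: (le_trans (metric_triangle _ (vertex R (g * a)%g) _)).
have H1 : mdist (edge g (g * a)%g s) (vertex R (g * a)%g) <= 1 - s.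
  rewrite -(edge1 ga); apply: (le_trans (mdist_edge ga _ _)).
  - by rewrite s0.
  - by rewrite ler01 lexx.
  - by rewrite distrC ger0_norm ?subr_ge0.
have H2 : mdist (vertex R (g * a)%g) (f (t - 1)) <= t - 1 - 0.
  by rewrite -f0; apply: fl; lra.
lra.
Qed.

Lemma mdist_vertex g h :
  mdist (vertex R g) (vertex R h) = (word_length (g^-1 * h)%g)%:R.
Proof.
apply/eqP; rewrite eq_le mdist_vertex_ge andbT.
have [w [wS <- ghw]] := word_lengthP (g^-1 * h)%g.
have [f [f0 fw fl]] := word_lipschitz_path g wS.
rewrite -ghw mulgA mulgV mul1g in fw.
by rewrite -f0 -fw; apply: le_trans (fl _ _ _ _ _) _ => //; rewrite subr0.
Qed.

(** A 1-Lipschitz path whose length equals the distance of its ends is geodesic; a shortest word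
    provides one. *)
Lemma vertex_geodesic g h : exists f : R -> X,
  [/\ f 0 = vertex R g, f (mdist (vertex R g) (vertex R h)) = vertex R h &
      geodesic `[0, mdist (vertex R g) (vertex R h)] f].
Proof.
have [w [wS sw ghw]] := word_lengthP (g^-1 * h)%g.
have [f [f0 fw fl]] := word_lipschitz_path g wS.
rewrite -ghw mulgA mulgV mul1g in fw.
have dE := mdist_vertex g h; rewrite -sw in dE.
exists f; split=> //; first by rewrite dE.
have H s t : 0 <= s -> s <= t -> t <= (size w)%:R -> mdist (f s) (f t) = t - s.
  move=> s0 st tw; have := fl _ _ s0 st tw.
  have H1 := fl _ _ (lexx 0) s0 (le_trans st tw).
  have H2 := fl _ _ (le_trans s0 st) tw (lexx _).
  have := metric_triangle (f 0) (f s) (f (size w)%:R).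
  have := metric_triangle (f s) (f t) (f (size w)%:R).
  have -> : mdist (f 0) (f (size w)%:R) = (size w)%:R by rewrite f0 fw.
  move=> T1 T2 T3.
  by apply/eqP; rewrite eq_le T3 /=; lra.
move=> s t; rewrite dE !in_itv/= => /andP[s0 sL] /andP[t0 tL].
have [st|/ltW ts] := leP s t; first by rewrite H// distrC ger0_norm ?subr_ge0.
by rewrite metric_sym H// ger0_norm ?subr_ge0.
Qed.

Lemma cayley_coarsely_geodesic : coarsely_geodesic (X := X).
Proof.
move=> x y; have [g xg] := close_vertex x; have [h yh] := close_vertex y.
have [f [f0 fL fg]] := vertex_geodesic g h.
set L := mdist _ _ in fL fg; have L0 : 0 <= L by exact: mdist_ge0.
(* If [L = 0], then [x] and [y] would compete for the same parameter; a jump on an interval of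
   length 1 is used instead. *)
have [L00|L1] := eqVneq L 0.
  exists 1, (fun t => if t <= 0 then x else y).
  have xy : mdist x y <= 2.
    have := metric_triangle x (vertex R g) y.
    have := metric_triangle (vertex R g) (vertex R h) y.
    by rewrite -/L L00 (metric_sym (vertex R h) y); lra.
  rewrite lexx ler10; split=> // s t.
  rewrite !in_itv/= invr1 !mul1r => /andP[? ?] /andP[? ?].
  have : `|s - t| <= 1 by rewrite ler_norml; lra.
  have := normr_ge0 (s - t); have := mdist_ge0 x y.
  by case: (leP s 0) => _; case: (leP t 0) => _; rewrite ?mdistxx ?(metric_sym y x) => *; apply/andP; split; lra.
exists L, (fun t => if t == 0 then x else if t == L then y else f t).
rewrite !eqxx (negbTE L1); split=> //.
have -> : 2 = 0 + 2 * 1 :> R by rewrite add0r mulr1.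
apply: (quasi_geodesic_perturb (lexx 1) (geodesic_quasi_geodesic fg)) => t _.
by do 2?case: eqP => [->|_]; rewrite ?f0 ?fL ?mdistxx.
Qed.

End CayleyGeometry.

Section CayleyAction.
Context {R : realType} {G : fg_group}.
Local Notation X := (cayley_graph R G).
Implicit Types (g h k : G) (x y : X) (s t : R).

Definition shift g (w : G -> R) : G -> R := fun k => w (g^-1 * k)%g.

Lemma shift_edge_point g a b t :
  shift g (edge_point a b t) = edge_point (g * a)%g (g * b)%g t.
Proof.
have E k a' : (g^-1 * k == a')%g = (k == g * a')%g.
  by apply/eqP/eqP => [<-|->]; rewrite ?mulKg ?mulgA ?mulgV ?mul1g.
by apply/funext => k; rewrite /shift /edge_point !E.
Qed.

Lemma adjacent_shift g a b : adjacent (g * a)%g (g * b)%g = adjacent a b.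
Proof.
have E a' b' : ((g * a')^-1 * (g * b') = a'^-1 * b')%g.
  by rewrite invgM -mulgA mulKg.
by rewrite /adjacent !E (inj_eq (mulgI g)).
Qed.

Lemma on_cayley_graph_shift g w : on_cayley_graph w -> on_cayley_graph (shift g w).
Proof.
move=> [a [b [t [ab t01 ->]]]]; exists (g * a)%g, (g * b)%g, t; split=> //.
  by rewrite adjacent_shift (inj_eq (mulgI g)).
exact: shift_edge_point.
Qed.

Lemma edge_path_shift g v w l :
  edge_path v w l -> edge_path (shift g v) (shift g w) l.
Proof.
elim=> {v w l} [w|a b s t w l ab s01 t01 _ IH]; first exact: edge_path_nil.
rewrite !shift_edge_point in IH *; apply: edge_path_cons => //.
by rewrite adjacent_shift.
Qed.

Definition act g x : X := CayleyPoint (on_cayley_graph_shift g (coordsP x)).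

Lemma actK g : cancel (act g) (act g^-1%g).
Proof.
by move=> x; apply: coords_inj; apply/funext => k;
  rewrite /= /shift invgK mulKg.
Qed.

Lemma act_vertex g h : act g (vertex R h) = vertex R (g * h)%g.
Proof. by apply: coords_inj; rewrite /= shift_edge_point. Qed.

Lemma mdist_act g x y : mdist (act g x) (act g y) = mdist x y.
Proof.
have H k u v : mdist (act k u) (act k v) <= mdist u v.
  apply: lb_le_inf; first exact: path_lengths_neq0.
  by move=> l /(edge_path_shift k) uvl; exact: mdist_cayley.
apply/eqP; rewrite eq_le H/=.
by rewrite -{1}(actK g x) -{1}(actK g y) H.
Qed.

Lemma morse_geodesic_act M I g (f : R -> X) :
  morse_geodesic M I f -> morse_geodesic M I (act g \o f).
Proof.
move=> [fI fM]; split=> [s t sI tI|l e a b eta l1 e0 ab etaQ [s sI sa] [t tI tb] r rab].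
  by rewrite mdist_act fI.
have actVK : cancel (act g^-1%g) (act g) by move=> x; rewrite -{1}(invgK g) actK.
have {}fM : closed_nbhd (f @` [set` I]) (M l e) ((act g^-1%g \o eta) r).
  apply: (fM l e a b) => //.
  - by move=> u v ua va; rewrite mdist_act; exact: etaQ.
  - by exists s => //; rewrite /= -sa /= actK.
  - by exists t => //; rewrite /= -tb /= actK.
apply: le_trans fM; apply: le_ereal_inf_tmp => _ [_ [u uI <-] <-].
apply: ge_ereal_inf; exists (edist (eta r, (act g \o f) u)).
  by exists ((act g \o f) u) => //; exists u.
apply: le_ereal_inf_tmp => _ [d [d0 fd] <-].
apply: edist_fin => //; move: fd; rewrite !ballEmdist /=.
by rewrite -{1}(actK g (f u)) mdist_act.
Qed.

End CayleyAction.

(** * Properness of the Cayley graph and limits of geodesics *)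

Section CayleyProper.
Context {R : realType} {G : fg_group}.
Local Notation X := (cayley_graph R G).
Local Notation e := (vertex R (1%g : G)).

Lemma word_ball_vertex (C : R) : exists B : seq G,
  forall g, mdist e (vertex R g) <= C -> g \in B.
Proof.
exists (word_ball (Num.truncn C)) => g; rewrite mdist_vertex invg1 mul1g => gC.
by apply: mem_word_ball; rewrite truncn_ge_nat// (le_trans _ gC).
Qed.

(** A ball meets finitely many edges, each a continuous image of [[0, 1]]. The clamp [cl] makes the
    parametrization of an edge Lipschitz on the whole line. *)
Lemma bounded_compact (C : R) :
  exists2 K : set X, compact K & forall x, mdist e x <= C -> K x.
Proof.
have [B BP] := word_ball_vertex (C + 1).
pose cl t : R := if t <= 0 then 0 else if 1 <= t then 1 else t.
have cl01 t : 0 <= cl t <= 1.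
  by rewrite /cl; case: (leP t 0) => ?; case: (leP 1 t) => ?;
    apply/andP; split; lra.
have cl_lip s t : `|cl s - cl t| <= `|s - t|.
  have := ler_norm (s - t); have := ler_norm (t - s); rewrite (distrC t s).
  rewrite /cl; case: (leP s 0) => ?; case: (leP t 0) => ?;
    case: (leP 1 s) => ?; case: (leP 1 t) => ? ? ?;
    by rewrite ler_norml; apply/andP; split; lra.
exists (\big[setU/set0]_(gh <- [seq (g, h) | g <- B, h <- B] |
    (gh.1 == gh.2) || adjacent gh.1 gh.2)
  ((fun t => edge gh.1 gh.2 (cl t) : X) @` `[0, 1])).
  apply: bigsetU_compact => -[g h] /= gh.
  apply: continuous_compact; last exact: segment_compact.
  apply: continuous_subspaceT => t.
  apply/metricType_numDomainType.cvgrPdist_lt => eps eps0.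
  near=> s; apply: (le_lt_trans (mdist_edge gh (cl01 _) (cl01 _))).
  apply: (le_lt_trans (cl_lip _ _)); near: s.
  exact: (@cvgr_dist_lt _ R^o).
move=> x xC; have [g [h [t [gh t01 xE]]]] := edgeP x.
have gB : g \in B.
  apply: BP; apply: (le_trans (metric_triangle _ x _)); rewrite lerD//.
  rewrite xE -(edge0 gh); apply: le_trans (mdist_edge gh t01 _) _.
    by rewrite lexx ler01.
  by move/andP: t01 => [? ?]; rewrite subr0 ger0_norm.
have hB : h \in B.
  apply: BP; apply: (le_trans (metric_triangle _ x _)); rewrite lerD//.
  rewrite xE -(edge1 gh); apply: le_trans (mdist_edge gh t01 _) _.
    by rewrite lexx ler01.
  by move/andP: t01 => [? ?]; rewrite ler_norml; lra.
rewrite -bigcup_seq_cond; exists (g, h) => /=.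
  by rewrite gh andbT; apply/allpairsP; exists (g, h).
exists t; first by rewrite /= in_itv.
rewrite xE /cl; move/andP: t01 => [t0 t1].
case: (leP t 0) => t0'; first by have -> : t = 0 by lra.
by case: (leP 1 t) => t1'; [have -> : t = 1 by lra|].
Unshelve. all: by end_near. Qed.

(** With an ultrafilter, bounded sequences converge without extraction, so limits at all times are
    taken simultaneously and no diagonal argument is made. *)
Lemma ultra_limit (F : set_system nat) (f : nat -> X) (C : R) :
  UltraFilter F -> F [set n | mdist e (f n) <= C] ->
  exists l, forall eps : R, 0 < eps -> F [set n | mdist (f n) l <= eps].
Proof.
move=> FU FC; have [K Kcomp KC] := bounded_compact C.
have FP : ProperFilter (f @ F) by exact: fmap_proper_filter.
have FK : (f @ F) K by apply: (filterS _ FC) => n; exact: KC.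
have [l [_ cl]] := Kcomp (f @ F) FP FK.
exists l => eps eps0; have [//|nF] := in_ultra_setVsetC [set n | mdist (f n) l <= eps] FU.
have ballP : nbhs l (ball l eps) by exact: nbhsx_ballx.
have [x [/= xl]] := cl [set x | ~ mdist x l <= eps] (ball l eps) nF ballP.
by rewrite ballEmdist/= metric_sym => /ltW.
Qed.

(* Arzela-Ascoli along an ultrafilter; being within 3 is all that is needed. *)
Lemma geodesic_limit (I : interval R) (f : nat -> R -> X) :
  (forall t, t \in I -> (Num.floor t)%:~R \in I) ->
  (forall K, \forall n \near \oo, forall s t, s \in I -> t \in I ->
    `|s| <= K -> `|t| <= K -> mdist (f n s) (f n t) = `|s - t|) ->
  (forall t, t \in I -> exists C, \forall n \near \oo, mdist e (f n t) <= C) ->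
  exists l, [/\ geodesic I l,
    forall K (n0 : nat), exists2 n, (n0 <= n)%N & forall t, t \in I -> `|t| <= K ->
      mdist (f n t) (l t) <= 3 &
    forall x t, t \in I -> (forall n, f n t = x) -> l t = x].
Proof.
move=> Ifl fg fb; have [F [FU ooF]] := ultraFilterLemma eventually_filter.
have /choice[l lP] : forall t, exists l, t \in I ->
    forall eps : R, 0 < eps -> F [set n | mdist (f n t) l <= eps].
  move=> t; have [tI|_] := boolP (t \in I); last by exists e.
  have [C fC] := fb _ tI.
  have [l lP] := ultra_limit FU (ooF _ fC).
  by exists l => _; exact: lP.
have lg : geodesic I l.
  move=> s t sI tI.
  have H eps : 0 < eps -> exists n, [/\ mdist (f n s) (l s) <= eps,
      mdist (f n t) (l t) <= eps & mdist (f n s) (f n t) = `|s - t|].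
    move=> eps0; have [n [[/= ns nt] nst]] := filter_ex (filterI (filterI (lP _ sI _ eps0)
      (lP _ tI _ eps0)) (ooF _ (fg (Num.max `|s| `|t|)))).
    by exists n; split=> //; apply: nst => //; rewrite le_max lexx ?orbT.
  apply/eqP; rewrite eq_le; apply/andP; split;
    apply/ler_addgt0Pl => eps eps0; have [|n [ns nt <-]] := H (eps / 2);
    rewrite ?divr_gt0//.
  - have := metric_triangle (l s) (f n s) (l t).
    have := metric_triangle (f n s) (f n t) (l t).
    by rewrite (metric_sym (l s) (f n s)); lra.
  - have := metric_triangle (f n s) (l s) (f n t).
    have := metric_triangle (l s) (l t) (f n t).
    by rewrite (metric_sym (l t) (f n t)); lra.
exists l; split=> // [K n0|x t tI fx]; last first.
  apply: mdist_positivity; apply/eqP; rewrite eq_le mdist_ge0 andbT.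
  apply/ler_addgt0Pl => eps eps0; have [n /=] := filter_ex (lP _ tI _ eps0).
  by rewrite fx metric_sym addr0.
pose N := (Num.truncn `|K|).+2.
have NK : K + 1 <= N%:R.
  have := truncnS_gt `|K|; have := ler_norm K; rewrite /N -[in X in _ -> _ -> X]natr1.
  lra.
(* Control at the finitely many integer times between [- N] and [N] suffices: any other time is
   within 1 of its floor, which accounts for [3 = 1 + 1 + 1] and for the closure of [I] under
   floors. *)
have FN m : F [set n | forall i, (i < m)%N -> i%:R - N%:R \in I ->
    mdist (f n (i%:R - N%:R)) (l (i%:R - N%:R)) <= 1].
  elim: m => [|m IH]; first by apply: filterS filterT => n _ i; rewrite ltn0.
  have [mI|mI] := boolP (m%:R - N%:R \in I); last first.
    apply: filterS IH => n H i; rewrite ltnS leq_eqVlt => /orP[/eqP->|]; last exact: H.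
    by rewrite (negbTE mI).
  apply: filterS (filterI IH (lP _ mI _ ltr01)) => n [H /= mn] i.
  by rewrite ltnS leq_eqVlt => /orP[/eqP->//|]; exact: H.
have n0F : F [set n | (n0 <= n)%N] by apply: ooF; exists n0.
have [n [[/= n0n nf] ng]] := filter_ex (filterI (filterI n0F (FN (N + N)%N))
  (ooF _ (fg (K + 1)))).
exists n => // t tI tK; move: (tK); rewrite ler_norml => /andP[t1 t2].
have tN : 0 <= t + N%:R by lra.
pose i := Num.truncn (t + N%:R).
have /andP[it ti] : i%:R <= t + N%:R < i.+1%:R by exact: truncn_itv.
have iI : i%:R - N%:R \in I.
  have <- : (Num.floor t)%:~R = i%:R - N%:R :> R; last exact: Ifl.
  have -> : Num.floor t = i%:Z - N%:Z.
    apply: floor_def; rewrite !rmorphD !rmorphN /= -!pmulrn.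
    by rewrite -natr1 in ti; apply/andP; split; lra.
  by rewrite rmorphB /= -!pmulrn.
have iN : (i < N + N)%N.
  by rewrite -(ltr_nat R) natrD; lra.
have := nf _ iN iI; rewrite -natr1 in ti.
have iK : `|i%:R - N%:R| <= K + 1 :> R by rewrite ler_norml; lra.
have tK1 : `|t| <= K + 1 by lra.
have ti1 : `|t - (i%:R - N%:R)| <= 1 by rewrite ler_norml; lra.
have := ng _ _ tI iI tK1 iK; have := lg _ _ tI iI.
set u := i%:R - N%:R in ti1 *.
have := metric_triangle (f n t) (f n u) (l t).
have := metric_triangle (f n u) (l u) (l t).
by rewrite (metric_sym (l t) (l u)); lra.
Qed.

End CayleyProper.

(** * Representative rays and shadows *)

Section BoundaryRays.
Context {R : realType} {X : metricType R} {o : X}.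
Implicit Types (r xi eta : R -> X) (z y : morse_boundary o).

Definition asymptotic r xi := finite_hausdorff_dist (r @` `[0, +oo[) (xi @` `[0, +oo[).

Lemma asymptotic_sym r xi : asymptotic r xi -> asymptotic xi r.
Proof. by move=> [C [? ?]]; exists C. Qed.

Lemma asymptotic_trans r xi eta : asymptotic r xi -> asymptotic xi eta -> asymptotic r eta.
Proof.
move=> /finite_hausdorff_distP[C [rxi xir]] /finite_hausdorff_distP[D [xieta etaxi]].
apply/finite_hausdorff_distP; exists (C + D); split=> t tI.
  by have [u uI tu] := rxi _ tI; exact: close_toD (xieta _ uI).
by have [u uI tu] := etaxi _ tI; rewrite addrC; exact: close_toD (xir _ uI).
Qed.

Lemma asymptotic_close_to r xi (C : R) :
  (forall t, 0 <= t -> mdist (r t) (xi t) <= C) -> asymptotic r xi.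
Proof.
move=> rxi; apply/finite_hausdorff_distP; exists C; split=> t tI;
  exists t => //; have t0 := tI; rewrite in_itv/= andbT in t0.
  exact: rxi.
by rewrite metric_sym; exact: rxi.
Qed.

Lemma rays_morse z xi : rays z xi -> morse_ray xi.
Proof. by have [eta _ ->] := raysP z; case. Qed.

Lemma rays_asymptotic z r xi : rays z r -> rays z xi -> asymptotic r xi.
Proof.
have [eta _ ->] := raysP z => -[_ reta] [_ /asymptotic_sym].
exact: asymptotic_trans.
Qed.

Lemma rays_closed z r xi : rays z xi -> morse_ray r -> asymptotic r xi -> rays z r.
Proof.
have [eta _ ->] := raysP z => -[_ xieta] rM rxi; split=> //.
exact: asymptotic_trans xieta.
Qed.

Lemma rays_inj z y r : rays z r -> rays y r -> z = y.
Proof.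
move=> zr yr; have E : rays z = rays y.
  apply/seteqP; split=> xi xiz; [apply: (rays_closed yr)|apply: (rays_closed zr)];
    by [exact: rays_morse xiz|apply: rays_asymptotic xiz _].
case: z y E {zr yr} => [S SP] [T TP] /= E; rewrite E in SP *.
by congr MorseDirection; exact: Prop_irrelevance.
Qed.

Lemma direction_of r : morse_ray r -> exists z, rays z r.
Proof.
move=> rM; have H : exists2 xi, morse_ray xi & morse_class r = morse_class xi by exists r.
exists (MorseDirection o H); split=> //.
by apply: (@asymptotic_close_to _ _ 0) => t _; rewrite mdistxx.
Qed.

End BoundaryRays.

Section CayleyRays.
Context {R : realType} {G : fg_group}.
Local Notation X := (cayley_graph R G).
Local Notation e := (vertex R (1%g : G)).
Implicit Types (g : G) (r xi : R -> X) (z : group_morse_boundary R G) (M N : morse_gauge R).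

Let cgX := cayley_coarsely_geodesic (R := R) (G := G).

Lemma floor_itv_ray (t : R) : t \in `[0, +oo[ -> (Num.floor t)%:~R \in `[(0 : R), +oo[.
Proof. by rewrite !in_itv/= !andbT => t0; rewrite ler0z floor_ge0. Qed.

(** The ray is a limit of geodesics from [e] to vertices along [xi]. They stay within a distance [K]
    of [xi] that does not depend on [n], so the limit is Morse by stability. *)
Lemma based_ray xi : morse_ray xi ->
  exists r, [/\ r 0 = e, morse_ray r & asymptotic r xi].
Proof.
move=> [M xiM]; have [v vP] := choice (fun n : nat => close_vertex (xi n%:R)).
have [f fP] := choice (fun n => vertex_geodesic (R := R) 1%g (v n)).
pose L n := mdist e (vertex R (v n)); pose d := mdist e (xi 0).
have d0 : 0 <= d by exact: mdist_ge0.
have nI n : n%:R \in `[(0 : R), +oo[ by rewrite in_itv/= andbT.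
have z0 : (0 : R) \in `[0, +oo[ by exact: nI 0%N.
have Ln n : n%:R <= L n + 1 + d.
  have := metric_triangle (xi 0) (xi n%:R) e.
  have := metric_triangle (xi 0) e (xi n%:R).
  have := metric_triangle e (vertex R (v n)) (xi n%:R).
  have := vP n; rewrite (metric_sym (vertex R (v n)) (xi n%:R)).
  rewrite (metric_sym (xi 0) e) (xiM.1 _ _ z0 (nI n)) sub0r normrN normr_nat -/(L n) -/d.
  lra.
pose K := M 1 (0 + 2 * (d + 1)) + (d + 1) + 1.
have fclose n t : t \in `[0, L n] -> close_to `[0, +oo[ xi K (f n t).
  have [f0 fL fg] := fP n.
  apply: (morse_close xiM _ (lexx 1) (lexx 0) _ (geodesic_quasi_geodesic fg)).
  - lra.
  - exact: mdist_ge0.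
  - by exists 0 => //; rewrite f0 -/d; lra.
  - by exists n%:R => //; rewrite fL metric_sym; have := vP n; lra.
have fseg (B : R) : \forall n \near \oo, forall t, t \in `[0, +oo[ -> `|t| <= B ->
    t \in `[0, L n].
  near=> n => t; rewrite !in_itv/= andbT => t0; rewrite ger0_norm// => tB.
  rewrite t0 /=; have := Ln n.
  have : B + 1 + d <= n%:R by near: n; exact: nbhs_infty_ger.
  lra.
have [B|t tI|r [rg rcl r0]] := geodesic_limit (I := `[0, +oo[) (f := f) floor_itv_ray.
- near=> n => s t sI tI sB tB; have [_ _ fg] := fP n.
  have H : forall t, t \in `[0, +oo[ -> `|t| <= B -> t \in `[0, L n].
    by near: n; exact: fseg.
  by apply: fg; exact: H.
- exists `|t|; near=> n; have [f0 _ fg] := fP n.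
  have H : forall s, s \in `[0, +oo[ -> `|s| <= `|t| -> s \in `[0, L n].
    by near: n; exact: fseg.
  by rewrite -f0 fg ?sub0r ?normrN//; apply: H => //; rewrite normr0.
have re : r 0 = e by apply: r0 => // n; have [] := fP n.
have rclose t : t \in `[0, +oo[ -> close_to `[0, +oo[ xi (3 + K) (r t).
  move=> tI; have [n0 _ n0P] := fseg `|t|.
  have [n n0n rn] := rcl `|t| n0.
  apply: close_toD (fclose n t _); last exact: n0P.
  by rewrite metric_sym; exact: rn.
exists r; split=> //.
  have K0 : 0 <= 3 + K by have [u _] := rclose _ z0; apply: le_trans; exact: mdist_ge0.
  have [N NP] := morse_stability (X := X) M K0; exists N; apply: NP => // s t.
  rewrite !in_itv/= !andbT => s0 t0 st; exists `[0, +oo[, xi; split=> // w.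
  rewrite in_itv/= => /andP[sw _]; apply: rclose; rewrite in_itv/= andbT.
  exact: le_trans sw.
have [D DP] := close_rays_hausdorff rg xiM.1 rclose.
apply/finite_hausdorff_distP; exists (Num.max (3 + K) D); split=> t tI.
  by apply: close_to_le (rclose _ tI); rewrite le_max lexx.
by apply: close_to_le (DP _ tI); rewrite le_max lexx orbT.
Unshelve. all: by end_near. Qed.

Lemma rep_exists z : exists r, rays z r /\ r 0 = e.
Proof.
have [xi zxi] : exists xi, rays z xi.
  have [xi xiM ->] := raysP z; exists xi; split=> //=.
  by apply: (@asymptotic_close_to _ _ _ _ 0) => t _; rewrite mdistxx.
have [r [r0 rM rxi]] := based_ray (rays_morse zxi).
by exists r; split=> //; exact: rays_closed zxi _ _.
Qed.

(** Fixing one ray per direction turns membership in strata and convergence into statements about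
    that ray, up to bounded changes of constants ([realization_close], [rep_close]). *)
Definition rep z : R -> X := projT1 (cid (rep_exists z)).

Lemma rep_rays z : rays z (rep z).
Proof. by rewrite /rep; case: cid => r []. Qed.

Lemma rep0 z : rep z 0 = e.
Proof. by rewrite /rep; case: cid => r []. Qed.

Lemma rep_geodesic z : geodesic `[0, +oo[ (rep z).
Proof. by have [M []] := rays_morse (rep_rays z). Qed.

Lemma rep_inj z y (C : R) :
  (forall t, 0 <= t -> mdist (rep z t) (rep y t) <= C) -> z = y.
Proof.
move=> /asymptotic_close_to zy; apply: (rays_inj (rep_rays z)).
by apply: (rays_closed (rep_rays y)) => //; exact: rays_morse (rep_rays z).
Qed.

(* A two-sided limit of the translates of a Morse ray by its own vertices. *)
Lemma morse_line xi : morse_ray xi ->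
  exists M c, morse_geodesic M `]-oo, +oo[ c /\ mdist e (c 0) <= 4.
Proof.
move=> [M xiM]; have [v vP] := choice (fun n : nat => close_vertex (xi n%:R)).
pose f n t := act (v n)^-1%g (xi (n%:R + t)).
have fseg (B : R) : \forall n \near \oo, forall t, `|t| <= B ->
    n%:R + t \in `[(0 : R), +oo[.
  near=> n => t; rewrite ler_norml in_itv/= andbT.
  have : B <= n%:R by near: n; exact: nbhs_infty_ger.
  lra.
have fb n t : n%:R + t \in `[(0 : R), +oo[ -> mdist e (f n t) <= `|t| + 1.
  move=> tI; have -> : e = act (v n)^-1%g (vertex R (v n)).
    by rewrite act_vertex mulVg.
  rewrite mdist_act; apply: (le_trans (metric_triangle _ (xi n%:R) _)).
  rewrite xiM.1//; last by rewrite in_itv/= andbT.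
  by rewrite opprD addNKr normrN addrC lerD2l metric_sym.
have [|B|t _|c [cg ccl _]] := geodesic_limit (I := `]-oo, +oo[) (f := f).
- by [].
- near=> n => s t _ _ sB tB.
  have H : forall t, `|t| <= B -> n%:R + t \in `[(0 : R), +oo[.
    by near: n; exact: fseg.
  by rewrite mdist_act xiM.1 ?H// opprD addrACA subrr add0r.
- exists (`|t| + 1); near=> n; apply: fb.
  have H : forall s, `|s| <= `|t| -> n%:R + s \in `[(0 : R), +oo[.
    by near: n; exact: fseg.
  exact: H.
have le03 : 0 <= 3 :> R by lra.
have [N NP] := morse_stability (X := X) M le03; exists N, c; split.
  apply: NP => // s t _ _ st.
  have [n0 _ n0P] := fseg (Num.max `|s| `|t|).
  have [n n0n cn] := ccl (Num.max `|s| `|t|) n0.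
  exists `[0, +oo[, (act (v n)^-1%g \o xi); split; first exact: morse_geodesic_act.
  move=> w; rewrite in_itv/= => /andP[sw wt].
  have wst : `|w| <= Num.max `|s| `|t|.
    rewrite le_max; have := ler_norm w; have := ler_norm (- w); rewrite normrN.
    have := ler_norm t; have := ler_norm (- s); rewrite normrN.
    case: (leP 0 w) => [w0|/ltW w0] *; apply/orP.
      by right; rewrite ger0_norm//; lra.
    by left; rewrite ler0_norm//; lra.
  by exists (n%:R + w); [exact: n0P|rewrite metric_sym; exact: cn].
have [n0 _ n0P] := fseg 0; have [n n0n cn] := ccl 0 n0.
have n00 : n%:R + 0 \in `[(0 : R), +oo[ by apply: n0P => //; rewrite normr0.
have := fb _ _ n00; have := cn 0 isT; rewrite normr0 lexx => /(_ isT).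
have := metric_triangle e (f n 0) (c 0); lra.
Unshelve. all: by end_near. Qed.

End CayleyRays.

Section Shadows.
Context {R : realType} {G : fg_group}.
Local Notation X := (cayley_graph R G).
Local Notation e := (vertex R (1%g : G)).
Implicit Types (g : G) (r xi : R -> X) (z : group_morse_boundary R G) (M N : morse_gauge R).

Let cgX := cayley_coarsely_geodesic (R := R) (G := G).

Definition morse_vertex M g := morse_point (e := e) M (vertex R g).

Section Line.
Context (N0 : morse_gauge R) (c : R -> X).
Context (cM : morse_geodesic N0 `]-oo, +oo[ c) (c0 : mdist e (c 0) <= 4).

Definition half_line g (b : bool) (t : R) := act g (c (if b then t else - t)).

Lemma half_line_morse : exists N, forall g b, morse_geodesic N `[0, +oo[ (half_line g b).
Proof.
have [N NP] := morse_stability (X := X) N0 (lexx 0); exists N => g b.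
apply: NP => [s t _ _|s t _ _ _].
  rewrite /half_line mdist_act; case: b; rewrite cM.1//.
  by rewrite -opprD normrN.
exists `]-oo, +oo[, (act g \o c); split; first exact: morse_geodesic_act.
by move=> v _; exists (if b then v else - v) => //; rewrite mdistxx.
Qed.

Lemma half_line0 g b : mdist (vertex R g) (half_line g b 0) <= 4.
Proof.
rewrite -[in vertex R g](mulg1 g) -act_vertex mdist_act.
by case: b; rewrite ?oppr0.
Qed.

(** Apply [morse_triangle] to the triangle with corners [e], [g] and a distant point of [r]: its
    sides from [g] to [e] and along the half-line are Morse. *)
Lemma shadow_ray_morse M : exists N, forall g b r, morse_vertex M g ->
  geodesic `[0, +oo[ r -> r 0 = e -> asymptotic r (half_line g b) ->
  morse_geodesic N `[0, +oo[ r.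
Proof.
have [N1 hM] := half_line_morse.
have [K [K0 KP]] := asymptotic_close cgX N1.
have [M2 [MM2 N1M2 _]] := gauge_ub M N1 0.
have C0 : 0 <= 4 + K by lra.
have [M3 M3P] := morse_triangle cgX M2 C0.
have [N NP] := morse_ray_of_segments (X := X) M3.
exists N => g b r [L [f [L0 f0 fL fM]]] rg r0 /finite_hausdorff_distP[C [_ rC]].
have [u0 u00 u0P] := KP _ _ rg (hM g b) (ex_intro _ C rC).
apply: NP => // B; exists (Num.max B u0); first by rewrite le_max lexx.
have b0 : 0 <= Num.max B u0 by rewrite le_max u00 orbT.
have sub : {subset `[0, Num.max B u0] <= `[(0 : R), +oo[}.
  by move=> x; rewrite !in_itv/= andbT => /andP[].
apply: (M3P _ _ _ _ _ _ _ (vertex R g) b0 (geodesic_sub sub rg)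
  (morse_geodesic_le MM2 fM) (morse_geodesic_le N1M2 (hM g b))).
- by exists L; [rewrite in_itv/= lexx L0|rewrite fL mdistxx].
- exists 0; first by rewrite in_itv/= lexx.
  by apply: le_trans (half_line0 g b) _; lra.
- by exists 0; [rewrite in_itv/= lexx L0|rewrite f0 r0 mdistxx].
- by apply: close_to_le (u0P _ _); [lra|rewrite le_max lexx orbT].
Qed.

(** The same triangle, now with Morse sides [r] and the half-line; the side from [e] to [g] is the
    one obtained. *)
Lemma shadow_point_morse N : exists M, forall g b r,
  morse_geodesic N `[0, +oo[ r -> r 0 = e -> asymptotic r (half_line g b) ->
  morse_vertex M g.
Proof.
have [N1 hM] := half_line_morse.
have [K [K0 KP]] := asymptotic_close cgX N1.
have [M2 [NM2 N1M2 _]] := gauge_ub N N1 0.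
have C0 : 0 <= 4 + K by lra.
have [M MP] := morse_triangle cgX M2 C0.
exists M => g b r rM r0 /finite_hausdorff_distP[C [_ rC]].
have [u0 u00 u0P] := KP _ _ rM.1 (hM g b) (ex_intro _ C rC).
have [f [f0 fL fg]] := vertex_geodesic (R := R) 1%g g.
have L0 : 0 <= mdist e (vertex R g) by exact: mdist_ge0.
exists (mdist e (vertex R g)), f; split=> //.
apply: (MP _ _ _ _ _ _ _ (r u0) L0 fg
  (morse_geodesic_le NM2 rM) (morse_geodesic_le N1M2 (hM g b))).
- by exists u0; [rewrite in_itv/= andbT|rewrite mdistxx].
- by apply: close_to_le (u0P _ (lexx _)); lra.
- by exists 0; [rewrite in_itv/= lexx|rewrite f0 r0 mdistxx].
- exists 0; first by rewrite in_itv/= lexx.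
  by rewrite fL; apply: le_trans (half_line0 g b) _; lra.
Qed.

(* The geodesic from e to its nearest point p on the line g c, continued along
   the line through g c(0), is a quasi-geodesic asymptotic to one of the rays. *)
Lemma shadow_ray_close N : exists D, forall g (r : bool -> R -> X),
  (forall b, [/\ morse_geodesic N `[0, +oo[ (r b), r b 0 = e &
     asymptotic (r b) (half_line g b)]) ->
  exists b, close_to `[0, +oo[ (r b) D (vertex R g).
Proof.
have [K [K0 KP]] := asymptotic_close cgX N.
exists (4 + (N (2 * 1 + 1) (0 + 7 + 2 * K) + K + 1)) => g r rP.
have [N1 hM] := half_line_morse.
have tin (t : R) : t \in `]-oo, +oo[ by [].
have [u _ near_u] := nearest_pointP (half_line g true) e (tin 0).
pose b := 0 <= u; pose p := if b then u else - u.
have p0 : 0 <= p by rewrite /p /b; case: ifPn; rewrite // -ltNge; lra.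
pose q t := half_line g b t.
have near_p t : mdist e (q p) <= mdist e (q t) + 1.
  have := near_u (if b then t else - t) (tin _).
  by rewrite /q /p /half_line; case: (b); rewrite ?opprK.
have qg : geodesic `]-oo, +oo[ q.
  move=> s t _ _; rewrite /q /half_line mdist_act; case: (b); rewrite cM.1//.
  by rewrite -opprD normrN.
(* The end opposite to the foot [p] of [e] is taken: the line from that end to [p] passes through
   parameter 0, that is, near [g]. *)
exists (~~ b); have [rM r0 ras] := rP (~~ b).
have [C [rh _]] := (finite_hausdorff_distP _ _ _ _).1 ras.
have [v v0 vP] := KP _ _ (hM g (~~ b)).1 rM (ex_intro _ C rh).
have vp : - v <= p by lra.
have z0 : 0 \in `[- v, p] by rewrite in_itv/=; apply/andP; split; lra.
apply: close_toD (half_line0 g b) _.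
apply: (morse_shortcut cgX (x := e) rM K0 (lexx 1) (lexx 0) vp _ _ _ _ z0) => //.
- by apply: geodesic_quasi_geodesic => s t _ _; exact: qg.
- have := vP v (lexx _); rewrite /q /half_line.
  by case: (b); rewrite ?opprK.
- by exists 0; [rewrite in_itv/= lexx|rewrite r0 mdistxx].
Qed.

End Line.

Lemma shadows xi : morse_ray xi -> exists z : G -> group_morse_boundary R G,
  (forall M, exists N D, forall g, morse_vertex M g ->
     morse_geodesic N `[0, +oo[ (rep (z g)) /\
     close_to `[0, +oo[ (rep (z g)) D (vertex R g)) /\
  (forall N, exists M, forall g, morse_geodesic N `[0, +oo[ (rep (z g)) ->
     morse_vertex M g).
Proof.
move=> /morse_line[N0 [c [cM c0]]].
have [N1 hM] := half_line_morse cM.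
have /choice[y yP] : forall gb : G * bool, exists y : group_morse_boundary R G,
    rays y (half_line c gb.1 gb.2).
  by move=> gb; apply: direction_of; exists N1.
pose rr g b := rep (y (g, b)).
have rrP g b : asymptotic (rr g b) (half_line c g b).
  exact: rays_asymptotic (rep_rays _) (yP (g, b)).
(* The end passing near [g] must be chosen before [M], and so before [D]. Closeness of the two rays
   to [g] is totally ordered, so one choice is at least as close for every [D] at once. *)
pose s g := `[< forall D, close_to `[0, +oo[ (rr g false) D (vertex R g) ->
  close_to `[0, +oo[ (rr g true) D (vertex R g) >].
have sP g b D : close_to `[0, +oo[ (rr g b) D (vertex R g) ->
    close_to `[0, +oo[ (rr g (s g)) D (vertex R g).
  rewrite /s; case: asboolP => [H|/existsNP[D0 /not_implyP[H1 H2]]]; case: b => //.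
    exact: H.
  move=> H; have [D0D|/ltW DD0] := leP D0 D; first exact: close_to_le D0D H1.
  by case: H2; exact: close_to_le DD0 H.
exists (fun g => y (g, s g)); split=> [M|N].
  have [N NP] := shadow_ray_morse cM c0 M.
  have [D DP] := shadow_ray_close cM c0 N.
  exists N, D => g gM.
  have rM b : morse_geodesic N `[0, +oo[ (rr g b).
    by apply: (NP g b) => //; [exact: rep_geodesic|exact: rep0].
  split; first exact: rM.
  have [b] := DP g (rr g) (fun b => And3 (rM b) (rep0 _) (rrP g b)).
  exact: sP.
have [M MP] := shadow_point_morse cM c0 N.
by exists M => g gN; apply: (MP g (s g) _ gN); [exact: rep0|exact: rrP].
Qed.

End Shadows.

(** * Convergence in the Morse boundary *)

Section MorseAt.
Context {R : realType} {X : metricType R}.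
Implicit Types (I : interval R) (g eta : R -> X) (M N : morse_gauge R).

Lemma finite_bound (P : nat -> R -> Prop) :
  (forall k c d, c <= d -> P k c -> P k d) -> (forall k, exists c, P k c) ->
  forall m, exists c, forall k, (k < m)%N -> P k c.
Proof.
move=> Ple Pex; elim=> [|m [c IH]]; first by exists 0.
have [d Pd] := Pex m; exists (Num.max c d) => k; rewrite ltnS leq_eqVlt.
move=> /orP[/eqP->|km]; first by apply: Ple Pd; rewrite le_max lexx orbT.
by apply: Ple (IH _ km); rewrite le_max lexx.
Qed.

(* The Morse condition at the single pair of constants (i + 1, i + 1); knowing
   it for all i suffices, since smaller constants are covered. *)
Definition morse_at I g (i : nat) (c : R) := forall (a b : R) eta, a <= b ->
  quasi_geodesic i.+1%:R i.+1%:R `[a, b] eta ->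
  (g @` [set` I]) (eta a) -> (g @` [set` I]) (eta b) ->
  forall t, t \in `[a, b] -> closed_nbhd (g @` [set` I]) c (eta t).

Lemma morse_at_le I g i (c d : R) : c <= d -> morse_at I g i c -> morse_at I g i d.
Proof.
move=> cd gc a b eta ab etaQ ga gb t tab.
by apply: le_trans (gc a b eta ab etaQ ga gb t tab) _; rewrite lee_fin.
Qed.

Lemma morse_geodesic_at M I g i : morse_geodesic M I g ->
  morse_at I g i (M i.+1%:R i.+1%:R).
Proof. by move=> [_ gM] a b eta ab; apply: gM => //; rewrite ler1n. Qed.

Lemma uniform_gauge (T : Type) I (g : T -> R -> X) : (forall n, geodesic I (g n)) ->
  (forall i, exists c, forall n, morse_at I (g n) i c) ->
  exists N, forall n, morse_geodesic N I (g n).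
Proof.
move=> gI /choice[c cP].
exists (abs_gauge (fun l e => c (Num.truncn (Num.max l e)))) => n; split=> //.
move=> l e a b eta l1 e0 ab etaQ ga gb t tab /=.
set i := Num.truncn _; apply: le_trans (cP i n a b eta ab _ ga gb t tab) _.
  have := truncnS_gt (Num.max l e); rewrite -/i gt_max => /andP[/ltW li /ltW ei].
  move=> u v uab vab; have /andP[H1 H2] := etaQ _ _ uab vab; apply/andP; split.
    apply: le_trans H1; apply: lerB => //; rewrite ler_wpM2r// lef_pV2//.
      by rewrite posrE (lt_le_trans ltr01) ?ler1n.
    by rewrite posrE (lt_le_trans ltr01).
  by apply: (le_trans H2); apply: lerD => //; rewrite ler_wpM2r.
by rewrite lee_fin ler_norm.
Qed.

(** Let [m + 1] be the least natural number that works for the ray. A quasi-geodesic showing that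
    [m] fails has its ends on some initial segment, so every longer segment also needs a constant
    above [m]. *)
Lemma morse_at_segment (g : R -> X) i : morse_ray g ->
  exists u0 : R, forall u c, u0 <= u -> 0 <= c ->
    morse_at `[0, u] g i c -> morse_at `[0, +oo[ g i (c + 1).
Proof.
move=> [M gM]; have H : exists m : nat, `[< morse_at `[0, +oo[ g i m%:R >].
  exists (Num.truncn (M i.+1%:R i.+1%:R)).+1; apply/asboolP.
  by apply: morse_at_le (morse_geodesic_at gM); rewrite ltW// truncnS_gt.
have [[|m] /asboolP gm min_m] := ex_minnP H.
  by exists 0 => u c _ c0 _; apply: morse_at_le gm; rewrite addr_ge0.
have /asboolPn/existsNP[a /existsNP[b /existsNP[eta]]] :
    ~~ `[< morse_at `[0, +oo[ g i m%:R >].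
  by apply/negP => /min_m; rewrite ltnn.
move=> /not_implyP[ab /not_implyP[etaQ /not_implyP[[s sI sa]
  /not_implyP[[t tI tb] /existsNP[r /not_implyP[rab far]]]]]].
rewrite /= in_itv/= andbT in sI; rewrite /= in_itv/= andbT in tI.
exists (Num.max s t) => u c; rewrite ge_max => /andP[su tu] c0 guc.
apply: morse_at_le gm; rewrite -natr1 lerD2r leNgt; apply/negP => /ltW cm.
apply: far; have := guc a b eta ab etaQ _ _ r rab => /(_ _ _)/wrap[].
- by exists s => //=; rewrite in_itv/= sI.
- by exists t => //=; rewrite in_itv/= tI.
move=> close; apply: le_trans (_ : (c%:E <= _)%E); last by rewrite lee_fin.
apply: le_trans close; apply: ereal_inf_le_tmp => _ [_ [v vu <-] <-].
exists (g v) => //; exists v => //; move: vu => /=.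
by rewrite !in_itv/= andbT => /andP[].
Qed.

End MorseAt.

Section BoundaryConvergence.
Context {R : realType} {G : fg_group}.
Local Notation X := (cayley_graph R G).
Local Notation e := (vertex R (1%g : G)).
Local Notation B := (group_morse_boundary R G).
Implicit Types (g : G) (r xi : R -> X) (z w : B) (M N : morse_gauge R).

Let cgX := cayley_coarsely_geodesic (R := R) (G := G).

Lemma realization_close M : exists D N, 0 <= D /\ forall z xi,
  rays z xi -> morse_geodesic M `[0, +oo[ xi -> xi 0 = e ->
  (forall t, 0 <= t -> mdist (rep z t) (xi t) <= D) /\
  morse_geodesic N `[0, +oo[ (rep z).
Proof.
have [D [N [D0 DN]]] := fellow_rays cgX M; exists D, N; split=> // z xi zxi xiM xi0.
apply: DN => //; first exact: rep_geodesic.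
  by rewrite xi0 rep0.
exact: rays_asymptotic (rep_rays z) zxi.
Qed.

Lemma rep_close N : exists D, forall z xi, morse_geodesic N `[0, +oo[ (rep z) ->
  rays z xi -> xi 0 = e -> forall t, 0 <= t -> mdist (xi t) (rep z t) <= D.
Proof.
have [D [N1 [D0 DN]]] := fellow_rays cgX N; exists D => z xi zN zxi xi0.
have [M [xig _]] := rays_morse zxi.
apply: (DN _ _ xig zN _ _).1; first by rewrite xi0 rep0.
exact: rays_asymptotic zxi (rep_rays z).
Qed.

Lemma morse_nbhd_close M : exists D, forall w y n, morse_stratum M w ->
  morse_nbhd M w n y ->
  forall t, 0 <= t -> t <= n%:R -> mdist (rep y t) (rep w t) <= D.
Proof.
have [D [N1 [D0 DP]]] := realization_close M.
exists (D + morse_delta M + D) => w y n [xi xiw] [eta etay fellow] t t0 tn.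
have [wxi xiM xi0] := xiw; have [yeta etaM eta0] := etay.
have H1 := (DP _ _ wxi xiM xi0).1 _ t0; have H2 := (DP _ _ yeta etaM eta0).1 _ t0.
have := fellow _ xiw t; rewrite in_itv/= t0 tn => /(_ isT).
have := metric_triangle (rep y t) (eta t) (rep w t).
have := metric_triangle (eta t) (xi t) (rep w t).
by rewrite (metric_sym (xi t) (rep w t)); lra.
Qed.

(** The bound of [morse_nbhd_close] does not depend on [n], so a direction in every neighbourhood of
    [w] has a ray at bounded distance from that of [w]. *)
Lemma morse_nbhd_sep M w y : morse_stratum M w -> y <> w ->
  exists n, ~ morse_nbhd M w n y.
Proof.
move=> Mw yw; apply: contrapT => H; apply: yw.
have [D DP] := morse_nbhd_close M.
apply: (@rep_inj _ _ _ _ D) => t t0; pose n := (Num.truncn t).+1.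
apply: (DP w y n) => //; last by rewrite ltW// truncnS_gt.
by apply: contrapT => wy; apply: H; exists n.
Qed.

Lemma morse_nbhd_sep_finite M w (b : nat -> B) m : morse_stratum M w ->
  exists n, forall i, (i < m)%N -> b i <> w -> ~ morse_nbhd M w n (b i).
Proof.
move=> Mw; elim: m => [|m [n IH]]; first by exists 0%N.
have [bmw|/(morse_nbhd_sep Mw)[n' Hn']] := pselect (b m = w).
  by exists n => i; rewrite ltnS leq_eqVlt => /orP[/eqP->//|]; exact: IH.
exists (maxn n n') => i; rewrite ltnS leq_eqVlt => /orP[/eqP-> _|im iw].
  by move=> /(morse_nbhd_le (leq_maxr n n')).
by move=> /(morse_nbhd_le (leq_maxl n n')); exact: IH.
Qed.

Lemma open_setC_far (A : set B) :
  (forall M w, morse_stratum M w -> ~ A w ->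
    exists n, forall b, A b -> ~ morse_nbhd M w n b) ->
  open (~` A).
Proof.
move=> H; suff : morse_open (~` A) by [].
move=> M; split=> [z []//|z [Az Mz]].
have [n nP] := H M z Mz Az; exists n => b bn; split; first by move=> /nP.
exact: morse_nbhd_stratum bn.
Qed.

Lemma cvg_eventually (y : nat -> B) z (V : set B) :
  y @ \oo --> z -> open V -> V z -> \forall n \near \oo, V (y n).
Proof. by move=> yz Vo Vz; apply: yz; exact: open_nbhs_nbhs. Qed.

Definition ray_cvg (y : nat -> B) z := exists N (E : R),
  (forall n, morse_geodesic N `[0, +oo[ (rep (y n))) /\
  forall k : R, \forall n \near \oo, forall t, 0 <= t -> t <= k ->
    mdist (rep (y n) t) (rep z t) <= E.

(** A gauge is taken so large that its tolerance exceeds [E + D]; in that stratum fellow-travelling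
    on [[0, k]] is membership in the [k]-th neighbourhood. *)
Lemma ray_cvg_cvg (y : nat -> B) z : ray_cvg y z -> y @ \oo --> z.
Proof.
move=> [N [E [yN yE]]] A; rewrite nbhsE => -[V [Vo Vz] VA].
have [Nz zN] := rays_morse (rep_rays z).
have [D DP] := rep_close Nz.
have [M [NM NzM deltaM]] := gauge_ub N Nz (E + D + 1).
have Mz : morse_stratum M z.
  exists (rep z); split; [exact: rep_rays|exact: morse_geodesic_le zN|exact: rep0].
have [_ /(_ z (conj Vz Mz))[k kV]] := (Vo : morse_open V) M.
have := yE k%:R; apply: filterS => n yn; apply/VA/(kV _ _).1.
exists (rep (y n)).
  by split; [exact: rep_rays|exact: morse_geodesic_le (yN n)|exact: rep0].
move=> xi [zxi xiM xi0] t; rewrite in_itv/= => /andP[t0 tk].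
have := yn _ t0 tk; have := DP _ _ zN zxi xi0 _ t0.
have := metric_triangle (rep (y n) t) (rep z t) (xi t).
by rewrite (metric_sym (rep z t) (xi t)); lra.
Qed.

(* A set meeting each stratum in finitely many points is closed; so a sequence
   of directions whose optimal constants blow up does not converge. *)
Lemma cvg_uniform_gauge (y : nat -> B) z : y @ \oo --> z ->
  exists N, forall n, morse_geodesic N `[0, +oo[ (rep (y n)).
Proof.
move=> yz; apply: uniform_gauge => [n|i]; first exact: rep_geodesic.
apply: contrapT => /forallNP H.
have bound (v : B) : exists c, morse_at `[0, +oo[ (rep v) i c.
  have [N vN] := rays_morse (rep_rays v).
  by exists (N i.+1%:R i.+1%:R); exact: morse_geodesic_at.
have /choice[n_ n_P] : forall j : nat, exists n, ~ morse_at `[0, +oo[ (rep (y n)) i j%:R.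
  by move=> j; apply/existsNP; exact: H.
(* The value [z] is left out so that the complement of [A] contains [z] even if [y] takes it at some
   of these indices. *)
pose A := [set b | exists2 j, b = y (n_ j) & b <> z].
have Ao : open (~` A).
  apply: open_setC_far => M w Mw Aw; have [D1 [N [D10 NP]]] := realization_close M.
  pose m := (Num.truncn (N i.+1%:R i.+1%:R)).+1.
  have [n nP] := morse_nbhd_sep_finite (y \o n_) m Mw.
  exists n => b [j bE bz] bw; apply: (nP j); rewrite /= -?bE //; last first.
    by move=> bw'; apply: Aw; rewrite -bw'; exists j.
  rewrite ltnNge; apply/negP => mj.
  have [eta [beta etaM eta0] _] := bw; have [_ bN] := NP _ _ beta etaM eta0.
  apply: (n_P j); rewrite -bE; apply: morse_at_le (morse_geodesic_at bN).
  by apply: (le_trans (ltW (truncnS_gt _))); rewrite ler_nat.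
have [n0 _ n0P] := cvg_eventually yz Ao ltac:(by move=> [j _ /(_ erefl)]).
have [c cP] := finite_bound (fun k => @morse_at_le _ _ `[0, +oo[ (rep (y k)) i)
  (fun k => bound (y k)) n0.
have [d dP] := bound z.
(* Beyond [c], which bounds the first [n0] terms, and [d], which bounds [z]: the index [n_ j] is
   then at least [n0] and its term lies in [A]. *)
pose j := (Num.truncn (Num.max c d)).+1.
have := truncnS_gt (Num.max c d); rewrite -/j gt_max => /andP[/ltW cj /ltW dj].
apply: (n_P j); have [jn0|n0j] := ltnP (n_ j) n0.
  exact: morse_at_le cj (cP _ jn0).
have [<-|yjz] := pselect (z = y (n_ j)); first exact: morse_at_le dj dP.
by case: (n0P _ n0j); exists j => // /esym.
Qed.

(** With a uniform gauge, bad indices give rays with a Morse limit ray [xi] of direction [y']. If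
    [y' = z], fellow-travelling with [xi] contradicts badness; otherwise the bad directions together
    with [y'] form a closed set missing [z]. *)
Lemma cvg_ray_cvg (y : nat -> B) z : y @ \oo --> z -> ray_cvg y z.
Proof.
move=> yz; have [N yN] := cvg_uniform_gauge yz; exists N.
have le03 : 0 <= 3 :> R by lra.
have [N' N'P] := morse_stability (X := X) N le03.
have [D [N1 [D0 DP]]] := realization_close N'.
exists (D + 3); split=> // k; apply: contrapT => bad.
have /choice[p pP] : forall i : nat, exists n, (i <= n)%N /\
    exists t, [/\ 0 <= t, t <= k & D + 3 < mdist (rep (y n) t) (rep z t)].
  move=> i; apply: contrapT => /forallNP H; apply: bad; exists i => // n /= ni t t0 tk.
  rewrite leNgt; apply/negP => far; apply: (H n); split=> //.
  by exists t; split.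
have [K|t tI|xi [xig xicl xi0]] :=
    geodesic_limit (I := `[0, +oo[) (f := fun i => rep (y (p i))) floor_itv_ray.
- by near=> n => s t sI tI _ _; exact: rep_geodesic.
- exists `|t|; near=> n; rewrite -(rep0 (y (p n))) rep_geodesic//.
    by rewrite sub0r normrN.
  by rewrite in_itv/= lexx.
have xie : xi 0 = e.
  by apply: xi0 => [|n]; [rewrite in_itv/= lexx|exact: rep0].
have /choice[m mP] : forall j : nat, exists n, (j <= n)%N /\
    forall t, 0 <= t -> t <= j%:R -> mdist (rep (y (p n)) t) (xi t) <= 3.
  move=> j; have [n jn nP] := xicl j%:R j; exists n; split=> // t t0 tj.
  by apply: nP; rewrite ?in_itv/= ?t0// ger0_norm.
have xiM : morse_geodesic N' `[0, +oo[ xi.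
  apply: N'P => // s t; rewrite !in_itv/= !andbT => s0 t0 st.
  pose j := (Num.truncn t).+1; have [_ jP] := mP j.
  exists `[0, +oo[, (rep (y (p (m j)))); split=> // v.
  rewrite in_itv/= => /andP[sv vt]; exists v; first by rewrite in_itv/= andbT; lra.
  rewrite metric_sym; apply: jP; first lra.
  by apply: (le_trans vt); rewrite ltW// truncnS_gt.
have [y' y'xi] : exists y' : B, rays y' xi by apply: direction_of; exists N'.
pose b j := y (p (m j)).
have badb j : exists t, [/\ 0 <= t, t <= k & D + 3 < mdist (rep (b j) t) (rep z t)].
  exact: (pP (m j)).2.
have [y'z|y'z] := pselect (y' = z).
  rewrite y'z in y'xi; pose j := (Num.truncn k).+1.
  have [t [t0 tk]] := badb j; apply/negP; rewrite -leNgt.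
  have := (DP _ _ y'xi xiM xie).1 _ t0.
  have := (mP j).2 _ t0 (le_trans tk (ltW (truncnS_gt k))).
  have := metric_triangle (rep (b j) t) (xi t) (rep z t).
  by rewrite (metric_sym (xi t) (rep z t)) -/(b j); lra.
pose A := [set v | v = y' \/ exists j, v = b j].
have Ao : open (~` A).
  apply: open_setC_far => M w Mw Aw; have [D' D'P] := morse_nbhd_close M.
  (* At time [T] the limit [xi] has left [rep w]. As [rep (b j)] follows [xi] up to [T] once
     [j >= j0], only finitely many [b j] remain to be separated from [w]. *)
  have [T [T0 farT]] : exists T, 0 <= T /\ D' + 3 < mdist (xi T) (rep w T).
    apply: contrapT => /forallNP H; apply: Aw; left.
    apply: (rays_inj (rep_rays w)); apply: (rays_closed y'xi).
      exact: rays_morse (rep_rays w).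
    apply: asymptotic_sym; apply: (@asymptotic_close_to _ _ _ _ (D' + 3)) => t t0.
    by rewrite leNgt; apply/negP => tfar; apply: (H t).
  pose j0 := (Num.truncn T).+1; have Tj0 : T <= j0%:R by rewrite ltW// truncnS_gt.
  have [n1 n1P] := morse_nbhd_sep_finite b j0 Mw.
  have [n2 n2P] : exists n, ~ morse_nbhd M w n y'.
    by apply: morse_nbhd_sep => // y'w; apply: Aw; left.
  exists (maxn j0 (maxn n1 n2)) => v [->|[j ->]] vw.
    by apply: n2P; apply: morse_nbhd_le vw; rewrite !leq_max leqnn !orbT.
  have [jj0|j0j] := ltnP j j0.
    apply: (n1P _ jj0); first by move=> bw; apply: Aw; right; exists j.
    by apply: morse_nbhd_le vw; rewrite !leq_max leqnn !orbT.
  have := D'P _ _ _ Mw vw _ T0; rewrite (le_trans Tj0) ?ler_nat ?leq_maxl//.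
  have := (mP j).2 _ T0; rewrite (le_trans Tj0) ?ler_nat// => /(_ isT) + /(_ isT).
  have := metric_triangle (xi T) (rep (b j) T) (rep w T).
  by rewrite (metric_sym (xi T) (rep (b j) T)) -/(b j); lra.
have Az : (~` A) z.
  move=> [zy'|[j zb]]; first exact: y'z.
  have [t [_ _]] := badb j; rewrite -zb mdistxx; lra.
have [n0 _ n0P] := cvg_eventually yz Ao Az.
have n0b : (n0 <= p (m n0))%N.
  by apply: leq_trans (mP n0).1 _; exact: (pP (m n0)).1.
by apply: (n0P _ n0b); right; exists n0.
Unshelve. all: by end_near. Qed.

End BoundaryConvergence.

(** * Convergence of group elements *)

Section PointConvergence.
Context {R : realType} {G : fg_group}.
Local Notation X := (cayley_graph R G).
Local Notation e := (vertex R (1%g : G)).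
Local Notation B := (group_morse_boundary R G).
Implicit Types (g h : G) (r xi : R -> X) (z w : B) (M N : morse_gauge R).

Let cgX := cayley_coarsely_geodesic (R := R) (G := G).

Definition len g : R := mdist e (vertex R g).

Definition seg g : R -> X := projT1 (cid (vertex_geodesic (R := R) 1%g g)).

Lemma segP g : [/\ seg g 0 = e, seg g (len g) = vertex R g & geodesic `[0, len g] (seg g)].
Proof. by rewrite /seg; case: cid. Qed.

Lemma len_ge0 g : 0 <= len g.
Proof. exact: mdist_ge0. Qed.

Lemma segment_seg M : exists D N, 0 <= D /\ forall g (L : R) eta, 0 <= L ->
  morse_geodesic M `[0, L] eta -> eta 0 = e -> eta L = vertex R g ->
  [/\ L = len g, morse_geodesic N `[0, len g] (seg g) &
      forall t, 0 <= t -> t <= len g -> mdist (seg g t) (eta t) <= D].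
Proof.
have [D [N [D0 ND]]] := fellow_travel (X := X) M (lexx 0).
exists D, N; split=> // g L eta L0 etaM eta0 etaL; have [s0 sL sg] := segP g.
have LE : L = len g.
  rewrite /len -eta0 -etaL etaM.1 ?in_itv/= ?lexx ?L0//.
  by rewrite sub0r normrN ger0_norm.
have I0 : 0 \in `[0, L] by rewrite in_itv/= lexx.
have I_ge0 (u : R) : u \in `[0, L] -> 0 <= u by rewrite in_itv/= => /andP[].
have [||sN close] := ND _ _ _ _ (len_ge0 g) sg etaM I0 I_ge0.
- by rewrite s0 eta0.
- by exists L; [rewrite in_itv/= lexx L0|rewrite etaL sL mdistxx].
by split=> // t t0 tL; apply: close; rewrite in_itv/= t0 -?LE// LE.
Qed.

Lemma ray_seg N (D : R) : exists E M, forall r g, morse_geodesic N `[0, +oo[ r -> r 0 = e ->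
  close_to `[0, +oo[ r D (vertex R g) ->
  morse_geodesic M `[0, len g] (seg g) /\
  forall t, 0 <= t -> t <= len g -> mdist (seg g t) (r t) <= E.
Proof.
have [E [M [E0 H]]] := fellow_travel (X := X) N (normr_ge0 D).
exists E, M => r g rN r0 rg; have [s0 sL sg] := segP g.
have [|u|||sM close] := H _ _ _ _ (len_ge0 g) sg rN.
- by rewrite in_itv/= lexx.
- by rewrite in_itv/= andbT.
- by rewrite s0 r0.
- by rewrite sL; apply: close_to_le rg; exact: ler_norm.
by split=> // t t0 tL; apply: close; rewrite in_itv/= ?t0.
Qed.

Lemma seg_ray M (D : R) : exists E N, forall r g u,
  morse_geodesic M `[0, len g] (seg g) -> geodesic `[0, +oo[ r -> r 0 = e ->
  0 <= u -> mdist (vertex R g) (r u) <= D ->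
  morse_geodesic N `[0, u] r /\
  forall t, 0 <= t -> t <= u -> t <= len g -> mdist (r t) (seg g t) <= E.
Proof.
have [E [N [E0 H]]] := fellow_travel (X := X) M (normr_ge0 D).
exists E, N => r g u sM rg r0 u0 ru; have [s0 sL _] := segP g.
have sub : {subset `[0, u] <= `[(0 : R), +oo[}.
  by move=> x; rewrite !in_itv/= andbT => /andP[].
have [|v|||rN close] := H _ _ _ _ u0 (geodesic_sub sub rg) sM.
- by rewrite in_itv/= lexx len_ge0.
- by rewrite in_itv/= => /andP[].
- by rewrite s0 r0.
- exists (len g); first by rewrite in_itv/= lexx len_ge0.
  by rewrite sL metric_sym; apply: le_trans ru _; exact: ler_norm.
by split=> // t t0 tu tL; apply: close; rewrite in_itv/= t0.
Qed.

(** A form of [morse_cvg] with chosen segments and an arbitrary bound [E] in place of the tolerance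
    [morse_delta]; the next two lemmas compare them. *)
Definition point_cvg (x : nat -> G) z := exists M (E : R),
  (forall n, morse_geodesic M `[0, len (x n)] (seg (x n))) /\
  forall k : R, \forall n \near \oo, k <= len (x n) /\
    forall t, 0 <= t -> t <= k -> mdist (seg (x n) t) (rep z t) <= E.

Lemma morse_cvg_point_cvg M (x : nat -> G) z :
  morse_cvg_gauge M (fun n => vertex R (x n)) z -> point_cvg x z.
Proof.
move=> [xM [xi xiz] xz]; have [zxi xiM xi0] := xiz.
have [D [N [D0 DP]]] := segment_seg M.
have [D' [N' [D'0 D'P]]] := realization_close (R := R) (G := G) M.
exists N, (D + morse_delta M + D'); split.
  by move=> n; have [L [eta [L0 eta0 etaL etaM]]] := xM n; have [] := DP _ _ _ L0 etaM eta0 etaL.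
move=> k; pose m := (Num.truncn k).+1; have km : k <= m%:R by rewrite ltW// truncnS_gt.
apply: filterS (xz m) => n [L [eta [mL etaM eta0 etaL fellow]]].
have L0 : 0 <= L by apply: le_trans mL.
have [LE _ close] := DP _ _ _ L0 etaM eta0 etaL.
split=> [|t t0 tk]; first by rewrite -LE; exact: le_trans mL.
have tm := le_trans tk km.
have := close t t0; rewrite -LE => /(_ (le_trans tm mL)).
have := fellow _ xiz t; rewrite in_itv/= t0 tm => /(_ isT).
have := (D'P _ _ zxi xiM xi0).1 _ t0.
have := metric_triangle (seg (x n) t) (eta t) (rep z t).
have := metric_triangle (eta t) (xi t) (rep z t).
by rewrite (metric_sym (rep z t) (xi t)); lra.
Qed.

Lemma point_cvg_morse_cvg (x : nat -> G) z :
  point_cvg x z -> morse_cvg (fun n => vertex R (x n)) z.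
Proof.
move=> [N [E [xN xz]]]; have [Nz zN] := rays_morse (rep_rays z).
have [D DP] := rep_close (R := R) (G := G) Nz.
have [M [NM NzM deltaM]] := gauge_ub N Nz (E + D + 1).
have xM n := morse_geodesic_le NM (xN n).
exists M; split=> [n||k].
- by have [s0 sL _] := segP (x n); exists (len (x n)), (seg (x n)); split; rewrite ?len_ge0.
- exists (rep z); split; [exact: rep_rays|exact: morse_geodesic_le zN|exact: rep0].
apply: filterS (xz k%:R) => n [kx close]; have [s0 sL _] := segP (x n).
exists (len (x n)), (seg (x n)); split=> // xi [zxi xiM xi0] t.
rewrite in_itv/= => /andP[t0 tk].
have := close _ t0 tk; have := DP _ _ zN zxi xi0 _ t0.
have := metric_triangle (seg (x n) t) (rep z t) (xi t).
by rewrite (metric_sym (rep z t) (xi t)); lra.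
Qed.

Lemma point_cvg_if (P : nat -> bool) (x y : nat -> G) z :
  point_cvg x z -> point_cvg y z ->
  point_cvg (fun n => if P n then x n else y n) z.
Proof.
move=> [M [E [xM xz]]] [N [F [yN yz]]].
have [K [MK NK _]] := gauge_ub M N 0.
exists K, (Num.max E F); split=> [n|k].
  by case: (P n); [exact: morse_geodesic_le (xM n)|exact: morse_geodesic_le (yN n)].
near=> n; have [kx xn] : k <= len (x n) /\ forall t, 0 <= t -> t <= k ->
  mdist (seg (x n) t) (rep z t) <= E by near: n; exact: xz.
have [ky yn] : k <= len (y n) /\ forall t, 0 <= t -> t <= k ->
  mdist (seg (y n) t) (rep z t) <= F by near: n; exact: yz.
by case: (P n); split=> // t t0 tk; rewrite le_max ?xn ?yn ?orbT.
Unshelve. all: by end_near. Qed.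

(* The last condition makes the Morse gauge of the
   point control that of the whole ray, at more and more constants. *)
Definition far_point (y : B) (j : nat) g := exists u : R,
  [/\ j%:R <= u, mdist (vertex R g) (rep y u) <= 1 &
      forall i c, (i <= j)%N -> 0 <= c -> morse_at `[0, u] (rep y) i c ->
        morse_at `[0, +oo[ (rep y) i (c + 1)].

Lemma far_point_len y j g : far_point y j g -> j%:R <= len g + 1.
Proof.
move=> [u [ju gu _]]; have u0 : 0 <= u by apply: le_trans ju.
have := metric_triangle e (vertex R g) (rep y u).
rewrite -{1}(rep0 y) rep_geodesic ?in_itv/= ?lexx ?u0//.
by rewrite sub0r normrN ger0_norm// -/(len g); lra.
Qed.

Lemma far_point_infinite y j (s : seq G) : exists g, far_point y j g /\ g \notin s.
Proof.
have /choice[u uP] : forall i, exists u0 : R, forall u c, u0 <= u -> 0 <= c ->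
    morse_at `[0, u] (rep y) i c -> morse_at `[0, +oo[ (rep y) i (c + 1).
  by move=> i; apply: morse_at_segment; exact: rays_morse (rep_rays y).
have [c cP] := @finite_bound R (fun i c => u i <= c)
  (fun i c d cd uc => le_trans uc cd) (fun i => ex_intro _ (u i) (lexx _)) j.+1.
have [d dP] : exists d : R, forall g, g \in s -> len g <= d.
  elim: s => [|a s [d dP]]; first by exists 0.
  exists (Num.max (len a) d) => g; rewrite inE => /orP[/eqP->|/dP gd].
    by rewrite le_max lexx.
  by rewrite le_max gd orbT.
(* Beyond the thresholds of all constants numbered up to [j], beyond [j], and so far that a vertex
   within 1 of [rep y v] is longer than every element of [s]. *)
pose v := Num.max (Num.max c j%:R) (d + 2).
have [cv jv dv] : [/\ c <= v, j%:R <= v & d + 2 <= v].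
  by rewrite /v !le_max !lexx !orbT.
have v0 : 0 <= v by apply: le_trans jv.
have [g gv] := close_vertex (rep y v); rewrite metric_sym in gv.
exists g; split.
  exists v; split=> // i a ij a0; apply: uP => //; apply: le_trans cv; exact: cP.
apply/negP => /dP; have := metric_triangle e (vertex R g) (rep y v).
rewrite -{1}(rep0 y) rep_geodesic ?in_itv/= ?lexx ?v0//.
by rewrite sub0r normrN ger0_norm// -/(len g); lra.
Qed.

Lemma far_point_cvg (y : nat -> B) (j : nat -> nat) (h : nat -> G) w :
  (forall n, far_point (y n) (j n) (h n)) ->
  (forall k, \forall n \near \oo, (k <= j n)%N) ->
  ray_cvg y w -> point_cvg h w.
Proof.
move=> yh joo [N [E [yN yw]]]; have [F [M FP]] := ray_seg N 1.
have yh_close n : close_to `[0, +oo[ (rep (y n)) 1 (vertex R (h n)).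
  have [u [ju hu _]] := yh n; exists u => //.
  by rewrite in_itv/= andbT; apply: le_trans ju.
exists M, (F + E); split=> [n|k]; first exact: (FP _ _ (yN n) (rep0 _) (yh_close n)).1.
pose m := (Num.truncn (k + 1)).+1.
have km : k + 1 <= m%:R by rewrite ltW// truncnS_gt.
near=> n.
have kh : k <= len (h n).
  have mj : (m <= j n)%N by near: n; exact: joo.
  by have := far_point_len (yh n); rewrite -(ler_nat R) in mj; lra.
split=> // t t0 tk; have := (FP _ _ (yN n) (rep0 _) (yh_close n)).2 _ t0 (le_trans tk kh).
have : forall t, 0 <= t -> t <= k -> mdist (rep (y n) t) (rep w t) <= E.
  by near: n; exact: yw.
move=> /(_ t t0 tk); have := metric_triangle (seg (h n) t) (rep (y n) t) (rep w t); lra.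
Unshelve. all: by end_near. Qed.

(** For each [i], all but finitely many [n] have [i <= j n], and then the constant read off the
    segment bounds that of the whole ray up to 1. The finitely many other rays are bounded one by
    one. *)
Lemma far_point_cvg_ray (y : nat -> B) (j : nat -> nat) (h : nat -> G) w :
  (forall n, far_point (y n) (j n) (h n)) ->
  (forall k, \forall n \near \oo, (k <= j n)%N) ->
  point_cvg h w -> ray_cvg y w.
Proof.
move=> yh joo [M [E [hM hw]]]; have [F [M' FP]] := seg_ray M 1.
have close n u : 0 <= u -> mdist (vertex R (h n)) (rep (y n) u) <= 1 -> _ :=
  FP _ _ _ (hM n) (rep_geodesic (y n)) (rep0 (y n)).
have [N yN] : exists N, forall n, morse_geodesic N `[0, +oo[ (rep (y n)).
  apply: uniform_gauge => [n|i]; first exact: rep_geodesic.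
  have [n0 _ n0P] := joo i.
  have [c cP] := finite_bound (fun k => @morse_at_le _ _ `[0, +oo[ (rep (y k)) i)
    (fun k => let: ex_intro N yN := rays_morse (rep_rays (y k)) in
      ex_intro _ _ (morse_geodesic_at yN)) n0.
  exists (Num.max c (M' i.+1%:R i.+1%:R + 1)) => n.
  have [nn0|n0n] := ltnP n n0.
    by apply: morse_at_le (cP _ nn0); rewrite le_max lexx.
  have [u [ju hu detect]] := yh n.
  have u0 : 0 <= u by apply: le_trans ju.
  apply: morse_at_le (detect i _ (n0P _ n0n) _ (morse_geodesic_at (close n u u0 hu).1)).
    by rewrite le_max lexx orbT.
  by apply: gauge_ge0; rewrite ?ler1n.
exists N, (F + E); split=> // k; pose m := (Num.truncn k).+1.
have km : k <= m%:R by rewrite ltW// truncnS_gt.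
near=> n => t t0 tk; have [u [ju hu _]] := yh n.
have u0 : 0 <= u by apply: le_trans ju.
have mj : (m <= j n)%N by near: n; exact: joo.
have ku : k <= u by rewrite -(ler_nat R) in mj; lra.
have [kh hn] : k <= len (h n) /\ forall t, 0 <= t -> t <= k ->
  mdist (seg (h n) t) (rep w t) <= E by near: n; exact: hw.
have := (close n u u0 hu).2 t t0 (le_trans tk ku) (le_trans tk kh).
have := hn t t0 tk; have := metric_triangle (rep (y n) t) (seg (h n) t) (rep w t); lra.
Unshelve. all: by end_near. Qed.

Lemma far_points_cvg w : exists2 a : nat -> G,
  (forall n, far_point w n (a n)) & point_cvg a w.
Proof.
have /choice[a aP] : forall n, exists g, far_point w n g.
  by move=> n; have [g [gP _]] := far_point_infinite w n [::]; exists g.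
exists a => //; apply: (far_point_cvg aP) => [k|]; first by exists k.
by apply: cvg_ray_cvg; exact: cvg_cst.
Qed.

(** The converse needs the lengths to diverge: a constant sequence [x] has a constant, hence
    convergent, image. *)
Definition detects_cvg (sh : G -> B) := forall (x : nat -> G) w,
  (point_cvg x w -> ray_cvg (sh \o x) w) /\
  (ray_cvg (sh \o x) w -> (forall k : R, \forall n \near \oo, k <= len (x n)) ->
    point_cvg x w).

Lemma detecting_map : B -> exists sh : G -> B, detects_cvg sh.
Proof.
move=> z0; have [sh [sh1 sh2]] := shadows (rays_morse (rep_rays z0)).
have morse_seg M g : morse_geodesic M `[0, len g] (seg g) -> morse_vertex M g.
  by have [s0 sL _] := segP g; exists (len g), (seg g); split; rewrite ?len_ge0.
exists sh => x w; split=> [[M [E [xM xw]]]|[N [E [xN xw]]] xoo].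
  have [N [D ND]] := sh1 M; have [F [M' FP]] := seg_ray M D.
  exists N, (F + E); split=> [n|k]; first exact: (ND _ (morse_seg _ _ (xM n))).1.
  near=> n => t t0 tk; have [_ [u uI hu]] := ND _ (morse_seg _ _ (xM n)).
  have u0 : 0 <= u by rewrite in_itv/= andbT in uI.
  have kD : k + D <= len (x n) by near: n; apply: filterS (xw (k + D)) => ? [].
  have [kx xn] : k <= len (x n) /\ forall t, 0 <= t -> t <= k ->
    mdist (seg (x n) t) (rep w t) <= E by near: n; exact: xw.
  have uD : len (x n) <= u + D.
    have := metric_triangle e (rep (sh (x n)) u) (vertex R (x n)).
    rewrite -{2}(rep0 (sh (x n))) rep_geodesic//; last by rewrite in_itv/= lexx.
    rewrite sub0r normrN ger0_norm// (metric_sym (rep (sh (x n)) u) (vertex R (x n))).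
    by rewrite -/(len (x n)); lra.
  have tu : t <= u by lra.
  have := (FP _ _ _ (xM n) (rep_geodesic _) (rep0 _) u0 hu).2 t t0 tu (le_trans tk kx).
  have := xn t t0 tk.
  have := metric_triangle (rep (sh (x n)) t) (seg (x n) t) (rep w t); rewrite /=; lra.
have [M1 M1P] := sh2 N; have [N1 [D ND]] := sh1 M1.
have [F [M FP]] := ray_seg N D.
have close n : close_to `[0, +oo[ (rep (sh (x n))) D (vertex R (x n)).
  exact: (ND _ (M1P _ (xN n))).2.
exists M, (F + E); split=> [n|k]; first exact: (FP _ _ (xN n) (rep0 _) (close n)).1.
near=> n; have kx : k <= len (x n) by near: n; exact: xoo.
split=> // t t0 tk.
have := (FP _ _ (xN n) (rep0 _) (close n)).2 t t0 (le_trans tk kx).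
have : forall t, 0 <= t -> t <= k -> mdist (rep (sh (x n)) t) (rep w t) <= E.
  by near: n; exact: xw.
move=> /(_ t t0 tk).
by have := metric_triangle (seg (x n) t) (rep (sh (x n)) t) (rep w t); lra.
Unshelve. all: by end_near. Qed.

End PointConvergence.

(** * The bijection *)

Section Bijections.

(** Greedy choice along [idx]: at stage [n] a value outside the list [L n] of earlier choices is
    taken. Stages that are no index make a dummy choice from [A i0]. *)
Lemma injective_choice (I : Type) (T : eqType) (idx : I -> nat) (i0 : I)
    (A : I -> set T) : injective idx ->
  (forall i (s : seq T), exists t, A i t /\ t \notin s) ->
  exists f : I -> T, injective f /\ forall i, A i (f i).
Proof.
move=> idx_inj Ainf.
have /choice[c cP] : forall ns : nat * seq T, exists t,
    (forall i, idx i = ns.1 -> A i t) /\ t \notin ns.2.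
  move=> [n s] /=; have [[i <-]|H] := pselect (exists i, idx i = n).
    by have [t [At ts]] := Ainf i s; exists t; split=> // j /idx_inj->.
  have [t [_ ts]] := Ainf i0 s; exists t; split=> // i iE.
  by case: H; exists i.
pose L := fix L n := if n is m.+1 then c (m, L m) :: L m else [::].
have LP m n : (m < n)%N -> c (m, L m) \in L n.
  elim: n => // n IH; rewrite ltnS leq_eqVlt => /orP[/eqP->|/IH mn] /=.
    by rewrite mem_head.
  by rewrite inE mn orbT.
have neq i j : (idx i < idx j)%N -> c (idx i, L (idx i)) <> c (idx j, L (idx j)).
  by move=> /LP ij cij; have [_ /=] := cP (idx j, L (idx j)); rewrite -cij ij.
exists (fun i => c (idx i, L (idx i))); split=> [i j cij|i].
  apply: idx_inj; case: (ltngtP (idx i) (idx j)) => // /neq;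
    by rewrite cij.
exact: (cP (idx i, L (idx i))).1.
Qed.

(** [C] collects the chains that start outside the image of [g]; [u] is [f] on them and the inverse
    of [g] elsewhere. The last clause keeps this, since compatibility with convergence is known only
    for [f] and [g]. *)
Lemma cantor_bernstein (S T : Type) (f : S -> T) (g : T -> S) :
  injective f -> injective g -> exists (u : S -> T) (v : T -> S),
    [/\ cancel u v, cancel v u & forall x, u x = f x \/ x = g (u x)].
Proof.
move=> f_inj g_inj.
pose C x := exists n y, (forall t, g t <> y) /\ x = iter n (g \o f) y.
have /choice[u uP] : forall x, exists t, (C x /\ t = f x) \/ (~ C x /\ x = g t).
  move=> x; have [Cx|nCx] := pselect (C x); first by exists (f x); left.
  have [[t xt]|H] := pselect (exists t, x = g t); first by exists t; right.
  by case: nCx; exists 0%N, x; split=> // t gt; apply: H; exists t.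
have CS x : C x -> C (g (f x)).
  by move=> [n [y [yP ->]]]; exists n.+1, y.
have u_inj : injective u.
  move=> x y uxy; have [[Cx ux]|[nCx ux]] := uP x; have [[Cy uy]|[nCy uy]] := uP y.
  - by apply: f_inj; rewrite -ux -uy.
  - by case: nCy; rewrite uy -uxy ux; exact: CS.
  - by case: nCx; rewrite ux uxy uy; exact: CS.
  - by rewrite ux uy uxy.
have /choice[v vP] : forall t, exists x, u x = t.
  move=> t; have [[[|n] [y [yP gt]]]|nC] := pselect (C (g t)).
  - by case: (yP t).
  - exists (iter n (g \o f) y); move: gt => /= /g_inj->.
    have Cn : C (iter n (g \o f) y) by exists n, y.
    by have [[_ ->]|[]] := uP (iter n (g \o f) y).
  - by exists (g t); have [[]|[_ /g_inj]] := uP (g t).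
exists u, v; split=> // [x|x]; first exact: u_inj.
by have [[_ ->]|[_ ?]] := uP x; [left|right].
Qed.

Lemma word_index (G : fg_group) : exists idx : G -> nat, injective idx.
Proof.
exists (fun g => pickle (word_length g, index g (word_ball (word_length g)))).
move=> g h /(pcan_inj pickleK)[ghl].
have gB := mem_word_ball (leqnn (word_length g)).
have hB := mem_word_ball (leqnn (word_length h)).
rewrite ghl in gB *; move=> gh.
by rewrite -(nth_index g gB) gh nth_index.
Qed.

End Bijections.

Section Escaping.
Context {R : realType} {G : fg_group}.
Implicit Types (x : nat -> G) (g : G).

Definition escapes x := forall g, \forall n \near \oo, x n <> g.

Lemma escapes_len x : escapes x -> forall k : R, \forall n \near \oo, k <= len (x n).
Proof.
move=> xoo k; have [B BP] := word_ball_vertex (R := R) (G := G) k.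
have : \forall n \near \oo, x n \notin B.
  elim: B {BP} => [|a B IH]; first by near=> n.
  near=> n; rewrite inE negb_or; apply/andP; split; last by near: n.
  by apply/eqP; near: n; exact: xoo.
apply: filterS => n; apply: contraR; rewrite -ltNge => /ltW xk.
exact: BP.
Unshelve. all: by end_near. Qed.

Lemma point_cvg_escapes x (z : group_morse_boundary R G) : point_cvg x z -> escapes x.
Proof.
move=> [M [E [_ xz]]] g; apply: filterS (xz (len g + 1)) => n [xl _] xg.
by move: xl; rewrite xg; lra.
Qed.

Lemma escapes_idx x (idx : G -> nat) : injective idx -> escapes x ->
  forall k, \forall n \near \oo, (k <= idx (x n))%N.
Proof.
move=> idx_inj xoo; elim=> [|k IH]; first by near=> n.
have xk : \forall n \near \oo, idx (x n) <> k.
  have [[g <-]|H] := pselect (exists g, idx g = k).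
    by apply: filterS (xoo g) => n xg /idx_inj.
  by near=> n => xk; apply: H; exists (x n).
near=> n; rewrite ltn_neqAle; apply/andP; split; last by near: n.
by apply/eqP => /esym; near: n.
Unshelve. all: by end_near. Qed.

End Escaping.

Lemma cvg_if (T : topologicalType) (P : nat -> bool) (u v : nat -> T) (l : T) :
  u @ \oo --> l -> v @ \oo --> l -> (fun n => if P n then u n else v n) @ \oo --> l.
Proof.
move=> ul vl A Al; have uA : \forall n \near \oo, A (u n) := ul A Al.
have vA : \forall n \near \oo, A (v n) := vl A Al.
suff : \forall n \near \oo, A (if P n then u n else v n) by [].
by near=> n; case: (P n); near: n.
Unshelve. all: by end_near.
Qed.

(* The pairs (x n, phat (x n)) are of two kinds, according to whether phat (x n)
   was chosen from x n or conversely.  Each kind is completed to a full sequence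
   by points known to converge, and is then treated separately. *)
Lemma preserves_morse_cvg_of_far_points (R : realType) (G H : fg_group)
    (p : group_morse_boundary R G -> group_morse_boundary R H)
    (q : group_morse_boundary R H -> group_morse_boundary R G)
    (shG : G -> group_morse_boundary R G) (shH : H -> group_morse_boundary R H)
    (idxG : G -> nat) (idxH : H -> nat) (phat : G -> H) (qhat : H -> G) :
  cancel q p -> continuous p -> detects_cvg shG -> detects_cvg shH ->
  injective idxG -> injective idxH -> cancel phat qhat ->
  (forall g, far_point (p (shG g)) (idxG g) (phat g) \/
             far_point (q (shH (phat g))) (idxH (phat g)) g) ->
  preserves_morse_cvg phat p.
Proof.
move=> qK pc shGP shHP idxG_inj idxH_inj phatK phatP M x z /morse_cvg_point_cvg xz.
pose w := p z; pose h n := phat (x n).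
have [a aP aw] := far_points_cvg w; have [b bP bz] := far_points_cvg z.
have x_esc := point_cvg_escapes xz.
have h_esc : escapes h.
  move=> k; apply: filterS (x_esc (qhat k)) => n xk hk; apply: xk.
  by rewrite -hk /h phatK.
pose P n := `[< far_point (p (shG (x n))) (idxG (x n)) (h n) >].
have infty_if (u : nat -> nat) (Q : nat -> bool) :
    (forall k, \forall n \near \oo, (k <= u n)%N) ->
    forall k, \forall n \near \oo, (k <= if Q n then u n else n)%N.
  move=> uoo k; near=> n; case: (Q n); near: n; first exact: uoo.
  by exists k.
have p_cvg (y : nat -> group_morse_boundary R G) : y @ \oo --> z -> p \o y @ \oo --> w.
  by move=> yz; apply: cvg_comp yz _; exact: pc.
(* First kind: [x] tends to [z], hence so do the directions [shG (x n)]; [p] carries them to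
   directions tending to [w], and far points on those follow. *)
have h1w : point_cvg (fun n => if P n then h n else a n) w.
  apply: (@far_point_cvg _ _ (fun n => if P n then p (shG (x n)) else w)
    (fun n => if P n then idxG (x n) else n)).
  - by move=> n; rewrite /P; case: asboolP => // _; exact: aP.
  - by apply: infty_if; exact: escapes_idx.
  apply: cvg_ray_cvg; apply: cvg_if; last exact: cvg_cst.
  by apply: (p_cvg (shG \o x)); apply: ray_cvg_cvg; exact: (shGP _ _).1.
(* Second kind: [x n] is a far point of [q (shH (h n))], so convergence goes from the points back to
   these directions and then through [p], where [qK] cancels [q]. *)
have x2z : point_cvg (fun n => if P n then b n else x n) z by exact: point_cvg_if.
have y2z : (fun n => if P n then z else q (shH (h n))) @ \oo --> z.
  apply: ray_cvg_cvg; apply: (far_point_cvg_ray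
    (j := fun n => if ~~ P n then idxH (h n) else n) _ _ x2z).
  - move=> n; rewrite /P; case: asboolP => [_|nP]; first exact: bP.
    by case: (phatP (x n)).
  - by apply: infty_if; exact: escapes_idx.
(* What is known now is convergence of the directions [shH (h n)]; returning to points needs that
   they leave finite sets, which [h] inherits from [x] by injectivity. *)
have h2w : point_cvg (fun n => if P n then a n else h n) w.
  have h2_esc : escapes (fun n => if P n then a n else h n).
    move=> k; near=> n; case: (P n); near: n; last exact: h_esc.
    exact: point_cvg_escapes aw k.
  apply: (shHP _ _).2; last exact: escapes_len.
  apply: cvg_ray_cvg.
  have -> : shH \o (fun n => if P n then a n else h n) =
      (fun n => if P n then shH (a n) else p (if P n then z else q (shH (h n)))).
    by apply/funext => n /=; case: (P n) => //; rewrite qK.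
  apply: cvg_if; last exact: p_cvg y2z.
  by apply: ray_cvg_cvg; exact: (shHP _ _).1.
have := point_cvg_if P h1w h2w; set h' := (fun n => _).
have -> : h' = h by apply/funext => n; rewrite /h'; case: (P n).
exact: point_cvg_morse_cvg.
Unshelve. all: by end_near. Qed.

(** Every finite group has empty boundary, whatever its order, so for finite groups a homeomorphism
    says nothing about cardinals; [finite_card] provides the bijection there. *)
Theorem corollary4p4 (R : realType) (G H : fg_group)
    (finite_card : finite_set [set: G] \/ finite_set [set: H] ->
       ([set: G] #= [set: H])%card)
    (p : group_morse_boundary R G -> group_morse_boundary R H)
    (q : group_morse_boundary R H -> group_morse_boundary R G)
    (hom_p : homeomorphism p q) :
  exists (phat : G -> H) (qhat : H -> G),
    [/\ cancel phat qhat, cancel qhat phat & induces phat qhat p q].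
Proof.
have [pK qK pc qc] := hom_p.
have [idxG idxG_inj] := word_index G; have [idxH idxH_inj] := word_index H.
have [[z0 _]|empty] := pselect (exists z0 : group_morse_boundary R G, True); last first.
  (* Without directions no sequence converges, so both preservation statements are vacuous and any
     bijection works. *)
  suff [u [v [uK vK]]] : exists (u : G -> H) (v : H -> G), cancel u v /\ cancel v u.
    exists u, v; split=> //; split=> [M x z|M x z] _; case: empty;
      [by exists z|by exists (q z)].
  have [fin|] := pselect (finite_set [set: G] \/ finite_set [set: H]).
    have /card_bijP[u [v uK vK]] := finite_card fin.
    pose i (K : fg_group) (k : K) : [set: K] := SigSub (mem_set (I : [set: K] k)).
    have iK (K : fg_group) (k : [set: K]) : i K (val k) = k by exact: val_inj.
    exists (fun g => val (u (i G g))), (fun h => val (v (i H h))).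
    by split=> k; rewrite iK ?uK ?vK.
  move=> /not_orP[Ginf Hinf].
  have inf (K : fg_group) : ~ finite_set [set: K] ->
      forall s : seq K, exists t : K, True /\ t \notin s.
    move=> Kinf s; apply: contrapT => /forallNP Hs; apply: Kinf.
    apply: (@sub_finite_set _ _ [set` s]); last exact: finite_seq.
    by move=> t _ /=; apply: contrapT => /negP ts; apply: (Hs t).
  have [f [f_inj _]] := injective_choice 1%g idxG_inj (fun=> inf H Hinf).
  have [g [g_inj _]] := injective_choice 1%g idxH_inj (fun=> inf G Ginf).
  by have [u [v [uK vK _]]] := cantor_bernstein f_inj g_inj; exists u, v.
have [shG shGP] := detecting_map z0.
have [shH shHP] := detecting_map (p z0).
have [f [f_inj fP]] := injective_choice 1%g idxG_inj
  (fun g s => far_point_infinite (p (shG g)) (idxG g) s).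
have [g [g_inj gP]] := injective_choice 1%g idxH_inj
  (fun h s => far_point_infinite (q (shH h)) (idxH h) s).
have [phat [qhat [phatK qhatK phatP]]] := cantor_bernstein f_inj g_inj.
exists phat, qhat; split=> //; split.
  apply: (preserves_morse_cvg_of_far_points qK pc shGP shHP idxG_inj idxH_inj phatK).
  move=> x; have [->|xE] := phatP x; first by left.
  by right; have := gP (phat x); rewrite -xE.
apply: (preserves_morse_cvg_of_far_points pK qc shHP shGP idxH_inj idxG_inj qhatK).
move=> h; have [hE|hE] := phatP (qhat h); rewrite qhatK in hE.
  by right; have := fP (qhat h); rewrite -hE.
by left; rewrite hE.
Qed.
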